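(* Let $F/K(x)$ be a Kummer extension given by $y^m=\prod_{i=1}^r(x-\alpha_i)^{\lambda_i}$ with $0<\lambda_i<m$. Fix $\alpha_0\in K\setminus\{\alpha_1,\dots,\alpha_r\}$ and set $\alpha_{r+1}:=\infty$, $\lambda_0:=0$, $\lambda_{r+1}:=-\sum_{i=0}^r\lambda_i$. For $u\in\{0,\dots,r+1\}$ let $P_u$ be the place of $K(x)$ corresponding to $\alpha_u\in K\cup\{\infty\}$ (zero of $x-\alpha_u$, resp. pole of $x$), and let $D_u=\sum_{Q\mid P_u}Q$ be the sum of all places of $F$ lying over $P_u$. Put $m_u=m/\gcd(m,\lambda_u)$ (with $\gcd(m,0)=m$ and $\gcd$ taken of absolute values), and let $t_u\in\{0,\dots,m_u-1\}$ be the unique element with $s+\frac{\lambda_u}{\gcd(m,\lambda_u)}t_u\equiv 0\pmod{m_u}$. Then for every integer $s\ge1$, $\ell(sD_u)-\ell((s-1)D_u)$ equals the number of $j\in\{0,\dots,\gcd(m,\lambda_u)-1\}$ such that $$\sum_{i=0}^r\left\{\frac{(t_u+jm_u)\lambda_i}{m}\right\}\le 1+\left\lfloor\frac{s-1}{m_u}\right\rfloor .$$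
   Context: $K$ is an algebraically closed field of characteristic $p\ge0$. A Kummer extension $F/K(x)$ is $F=K(x,y)$ with $y^m=f(x)=\prod_{i=1}^r(x-\alpha_i)^{\lambda_i}$, where $m\ge2$, $p\nmid m$, $0<\lambda_i<m$, the $\alpha_i\in K$ are pairwise distinct, and $f$ is not a $d$-th power in $K(x)$ for any divisor $d>1$ of $m$. For a divisor $D$ of $F$, $\ell(D)=\dim_K\{z\in F:(z)\ge -D\}\cup\{0\}$. $\{x\}=x-\lfloor x\rfloor$ is the fractional part. *)

(* Defs.v *)
From HB Require Import structures.
From mathcomp Require Import all_boot all_order all_algebra all_field.
Set Implicit Arguments. Unset Strict Implicit. Unset Printing Implicit Defensive.
Import Order.TTheory GRing.Theory Num.Theory.
Local Open Scope ring_scope.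

Definition evalxy (K F : fieldType) (emb : {rmorphism K -> F}) (x y : F)
  (p : {poly {poly K}}) : F :=
  (map_poly (fun c : {poly K} => (map_poly emb c).[x]) p).[y].

Definition kummer_poly (K : fieldType) (r : nat) (alpha : nat -> K)
  (lam : nat -> nat) : {poly K} :=
  \prod_(1 <= i < r.+1) ('X - (alpha i)%:P) ^+ lam i.

(* A place of F/K, represented by its normalized discrete valuation
   v : F -> int (the value at 0 is irrelevant / never used), trivial on K. *)
Definition is_place (K F : fieldType) (emb : {rmorphism K -> F}) (v : F -> int)
  : Prop :=
  [/\ forall a b : F, a != 0 -> b != 0 -> v (a * b) = v a + v b,
      forall a b : F, a != 0 -> b != 0 -> a + b != 0 ->
        Num.min (v a) (v b) <= v (a + b),
      forall c : K, c != 0 -> v (emb c) = 0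
    & exists z : F, z != 0 /\ v z = 1].

Definition lamE (r : nat) (lam : nat -> nat) (u : nat) : int :=
  if u == 0%N then 0
  else if (u <= r)%N then (lam u)%:Z
  else - ((\sum_(1 <= i < r.+1) lam i)%N)%:Z.

(* Q | P_u : for u <= r, Q is a zero of x - alpha_u (alpha_0 the extra point);
   for u = r+1 (alpha_{r+1} = infinity), Q is a pole of x. *)
Definition lies_over (K F : fieldType) (emb : {rmorphism K -> F}) (x : F)
  (r : nat) (alpha : nat -> K) (u : nat) (v : F -> int) : bool :=
  if (u <= r)%N then 0 < v (x - emb (alpha u)) else v x < 0.

Definition in_LD (K F : fieldType) (emb : {rmorphism K -> F}) (x : F)
  (r : nat) (alpha : nat -> K) (u : nat) (c : nat) (z : F) : Prop :=
  z = 0 \/ forall v : F -> int, is_place emb v ->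
    - (if lies_over emb x r alpha u v then c%:Z else 0) <= v z.

Definition ell_is (K F : fieldType) (emb : {rmorphism K -> F}) (x : F)
  (r : nat) (alpha : nat -> K) (u : nat) (c : nat) (n : nat) : Prop :=
  exists b : 'I_n -> F,
    [/\ forall k, in_LD emb x r alpha u c (b k),
        forall cf : 'I_n -> K, \sum_(k < n) emb (cf k) * b k = 0 ->
          forall k, cf k = 0
      & forall z, in_LD emb x r alpha u c z ->
          exists cf : 'I_n -> K, z = \sum_(k < n) emb (cf k) * b k].

Definition fracp (q : rat) : rat := q - (Num.floor q)%:~R.

(* Main.v *)
(** The places of [F] are unknown a priori, but the Galois group of [F/K(x)],
    generated by [y |-> zeta y], permutes them and preserves [L(c D_u)].
    Averaging over it shows that [L(c D_u)] is the direct sum of its subspaces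
    of monomials [h(x) y^k], [0 <= k < m].  Since a place above [alpha_i] has
    ramification index [m / gcd(m, lambda_i)], the monomial condition reads
    [ord_i h >= - floor ((c gcd(m, lambda_u) [i = u] + k lambda_i) / m)] at each
    [alpha_i], infinity included, so that the subspace for [k] has dimension
    [max(0, 1 + sum_i floor(...))].  Passing from [c = s - 1] to [c = s] changes
    it, by one, only when [k = t mod m_u] and the sum is nonnegative, and this
    last condition is the inequality on fractional parts.

    Locally [y^m = t^l U(t)] with [U(0) != 0].  Truncated [m]-th roots of the
    power series [U] embed [F] in the Laurent series over [K], which gives a
    place above [t = 0]; truncated [gcd(m, l)]-th roots show that there is no
    ramification other than the forced one. *)

Require Import Defs.
From HB Require Import structures.
From mathcomp Require Import all_boot all_order all_algebra all_field.
From mathcomp Require Import zify ring.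
From Stdlib Require Import IndefiniteDescription.
Set Implicit Arguments. Unset Strict Implicit. Unset Printing Implicit Defensive.
Import Order.TTheory GRing.Theory Num.Theory.
Local Open Scope ring_scope.

(** * Evaluation and places *)

(** The space L(c D_u) is defined by a condition at every place, so two facts about places carry the
    proof. Every place over a given point has the forced ramification index; this fixes the value of
    a monomial h(x) y^k at all places over that point. And over each point of the line at least one
    place exists, also where f does not vanish; without it nothing would exclude further poles of h.
    Both facts are proved for one local model, y^m = t^l U(t) with the powers of y generating F over
    K(t), so that finite points and infinity share the argument. Values are read off from
    congruences with polynomials to sufficiently high order, which stand in for completions. *)

Section Evaluation.
Variables (K F : fieldType) (emb : {rmorphism K -> F}).

Definition pev (x : F) : {poly K} -> F := horner_eval x \o map_poly emb.
HB.instance Definition _ x :=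
  GRing.RMorphism.copy (pev x) (horner_eval x \o map_poly emb).

Lemma pevE x p : pev x p = (map_poly emb p).[x]. Proof. by []. Qed.

Lemma pevC x c : pev x c%:P = emb c.
Proof. by rewrite pevE map_polyC hornerC. Qed.

Lemma pevX x : pev x 'X = x.
Proof. by rewrite pevE map_polyX hornerX. Qed.

Lemma pevZ x c p : pev x (c *: p) = emb c * pev x p.
Proof. by rewrite -mul_polyC rmorphM /= pevC. Qed.

Lemma pevXsubC x c : pev x ('X - c%:P) = x - emb c.
Proof. by rewrite rmorphB /= pevX pevC. Qed.

Lemma pev_comp x p q : pev x (p \Po q) = pev (pev x q) p.
Proof. by rewrite !pevE map_comp_poly horner_comp. Qed.

Definition pev2 (x y : F) : {poly {poly K}} -> F :=
  horner_eval y \o map_poly (pev x).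
HB.instance Definition _ x y :=
  GRing.RMorphism.copy (pev2 x y) (horner_eval y \o map_poly (pev x)).

Lemma pev2E x y P : pev2 x y P = (map_poly (pev x) P).[y]. Proof. by []. Qed.

Lemma evalxyE x y P : evalxy emb x y P = pev2 x y P. Proof. by []. Qed.

Lemma pev2C x y p : pev2 x y p%:P = pev x p.
Proof. by rewrite pev2E map_polyC hornerC. Qed.

Lemma pev2X x y : pev2 x y 'X = y.
Proof. by rewrite pev2E map_polyX hornerX. Qed.

Lemma pev2_sum x y P : pev2 x y P = \sum_(i < size P) pev x P`_i * y ^+ i.
Proof.
rewrite {1}[P](esym (coefK P)) poly_def rmorph_sum /=; apply: eq_bigr => i _.
by rewrite -mul_polyC rmorphM rmorphXn /= pev2C pev2X.
Qed.

Definition transcendental (x : F) := forall p, pev x p = 0 -> p = 0.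

Lemma transcendental_subC_neq0 x c : transcendental x -> x - emb c != 0.
Proof.
move=> trx; apply/eqP; rewrite -pevXsubC => /trx /eqP.
by rewrite polyXsubC_eq0.
Qed.

Lemma pev_eq0 x p : transcendental x -> (pev x p == 0) = (p == 0).
Proof.
by move=> trx; apply/eqP/eqP => [/trx //|->]; rewrite rmorph0.
Qed.

End Evaluation.

Section Place.
Variables (K F : fieldType) (emb : {rmorphism K -> F}) (v : F -> int).
Hypothesis v_place : is_place emb v.

Lemma placeM a b : a != 0 -> b != 0 -> v (a * b) = v a + v b.
Proof. by case: v_place => vM _ _ _; apply: vM. Qed.

Lemma place_emb c : c != 0 -> v (emb c) = 0.
Proof. by case: v_place => _ _ vK _; apply: vK. Qed.

Lemma place1 : v 1 = 0.
Proof. by rewrite -(rmorph1 emb) place_emb ?oner_eq0. Qed.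

Lemma placeN a : a != 0 -> v (- a) = v a.
Proof.
move=> a0; rewrite -mulN1r placeM ?oppr_eq0 ?oner_eq0 //.
by rewrite -(rmorph1 emb) -rmorphN place_emb ?add0r // oppr_eq0 oner_eq0.
Qed.

Lemma placeV a : a != 0 -> v a^-1 = - v a.
Proof.
move=> a0; apply/eqP; rewrite -addr_eq0 addrC -placeM ?invr_eq0 //.
by rewrite mulfV // place1.
Qed.

Lemma placeX a n : a != 0 -> v (a ^+ n) = v a *+ n.
Proof.
move=> a0; elim: n => [|n IHn]; first by rewrite expr0 place1.
by rewrite exprS mulrS placeM ?expf_neq0 // IHn.
Qed.

Lemma placeXz a (n : int) : a != 0 -> v (a ^ n) = v a * n.
Proof.
move=> a0; case: n => n; first by rewrite -exprnP placeX // -mulr_natr natz.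
rewrite NegzE -invr_expz placeV ?expfz_neq0 // -exprnP placeX //.
by rewrite mulrN -mulr_natr natz.
Qed.

Lemma place_prod (I : Type) (s : seq I) (P : pred I) (f : I -> F) :
    (forall i, f i != 0) ->
  v (\prod_(i <- s | P i) f i) = \sum_(i <- s | P i) v (f i).
Proof.
move=> f0; suff [] : \prod_(i <- s | P i) f i != 0 /\
  v (\prod_(i <- s | P i) f i) = \sum_(i <- s | P i) v (f i) by [].
apply: (big_rec2 (fun a b => a != 0 /\ v a = b)).
  by rewrite oner_eq0 place1.
by move=> i a b _ [a0 <-]; rewrite mulf_neq0 // placeM.
Qed.

(** A place is unconstrained at 0, so 0 is given infinite value here; bounds are then stable under
    sums and products without side conditions. *)
Definition vge (n : int) (z : F) := (z == 0) || (n <= v z).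

Lemma vge0 n : vge n 0. Proof. by rewrite /vge eqxx. Qed.

Lemma vgeW n n' z : n' <= n -> vge n z -> vge n' z.
Proof.
by rewrite /vge => le /orP[->//|h]; rewrite (le_trans le h) orbT.
Qed.

Lemma vgeP n z : z != 0 -> vge n z = (n <= v z).
Proof. by rewrite /vge => /negPf ->. Qed.

Lemma vgeD n a b : vge n a -> vge n b -> vge n (a + b).
Proof.
rewrite /vge; case: (eqVneq a 0) => [->|a0 /= ha]; first by rewrite add0r.
case: (eqVneq b 0) => [->|b0 /= hb]; first by rewrite addr0 ha orbT.
case: (eqVneq (a + b) 0) => //= ab0.
case: v_place => _ vD _ _; apply: le_trans (vD _ _ a0 b0 ab0).
by rewrite le_min ha.
Qed.

Lemma vgeN n a : vge n a -> vge n (- a).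
Proof.
by rewrite /vge oppr_eq0; case: (eqVneq a 0) => //= a0; rewrite placeN.
Qed.

Lemma vgeB n a b : vge n a -> vge n b -> vge n (a - b).
Proof. by move=> ha hb; rewrite vgeD ?vgeN. Qed.

Lemma vgeM n n' a b : vge n a -> vge n' b -> vge (n + n') (a * b).
Proof.
rewrite /vge mulf_eq0; case: (eqVneq a 0) => //= a0.
by case: (eqVneq b 0) => //= b0 ha hb; rewrite placeM // lerD.
Qed.

Lemma vge_sum n (I : Type) (s : seq I) (P : pred I) (f : I -> F) :
  (forall i, P i -> vge n (f i)) -> vge n (\sum_(i <- s | P i) f i).
Proof.
by move=> h; apply: (big_ind (vge n)) => //; [apply: vge0|apply: vgeD].
Qed.

Lemma vge_emb c : vge 0 (emb c).
Proof.
by rewrite /vge fmorph_eq0; case: (eqVneq c 0) => //= c0; rewrite place_emb.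
Qed.

Lemma vge0X a n : vge 0 a -> vge 0 (a ^+ n).
Proof.
move=> ha; elim: n => [|n IHn]; first by rewrite expr0 -(rmorph1 emb) vge_emb.
by rewrite exprS -[0]addr0 vgeM.
Qed.

(** Strict ultrametric inequality: approximating [a] beyond the order of its own value preserves
    that value, and nonvanishing. *)
Lemma place_congr a b :
  a != 0 -> vge (v a + 1) (b - a) -> b != 0 /\ v b = v a.
Proof.
move=> a0 hba.
have b0 : b != 0.
  apply/negP => /eqP b0; move: hba.
  by rewrite b0 sub0r vgeP ?oppr_eq0 // placeN // gerDl.
split=> //; apply/eqP; rewrite eq_le; apply/andP; split; last first.
  rewrite -vgeP // -(subrK a b); apply: vgeD; last by rewrite vgeP.
  by apply: vgeW hba; rewrite lerDl.
rewrite leNgt; apply/negP => lt.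
have : vge (v a + 1) a.
  rewrite -[X in vge _ X](subKr b); apply: vgeB => //.
  by rewrite vgeP // lezD1.
by rewrite vgeP // gerDl.
Qed.

Lemma vge_pev x p : vge 0 x -> vge 0 (pev emb x p).
Proof.
move=> hx; elim/poly_ind: p => [|p c IHp]; first by rewrite rmorph0 vge0.
by rewrite rmorphD rmorphM /= pevX pevC vgeD ?vge_emb // -[0]addr0 vgeM.
Qed.

Lemma vge_subC x c : vge 0 (x - emb c) -> vge 0 x.
Proof. by move=> h; rewrite -(subrK (emb c) x) vgeD ?vge_emb. Qed.

Lemma vge_pev_sub x c p :
  vge 1 (x - emb c) -> vge 1 (pev emb x p - emb p.[c]).
Proof.
move=> h1.
have h0 : vge 0 x by apply: (@vge_subC _ c); apply: vgeW h1.
have /factor_theorem[q hq] : root (p - p.[c]%:P) c.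
  by rewrite /root hornerD hornerN hornerC subrr.
rewrite -(pevC emb x) -rmorphB /= hq rmorphM /= pevXsubC -[1]add0r vgeM //.
exact: vge_pev.
Qed.

Lemma place_pev_unit x c p : vge 1 (x - emb c) -> p.[c] != 0 ->
  pev emb x p != 0 /\ v (pev emb x p) = 0.
Proof.
move=> h1 pc0.
have e0 : emb p.[c] != 0 by rewrite fmorph_eq0.
have [| -> ->] := @place_congr (emb p.[c]) (pev emb x p) e0.
  by rewrite place_emb // add0r; apply: vge_pev_sub.
by rewrite place_emb.
Qed.

Lemma place_pev_order x c p : 0 < v (x - emb c) -> pev emb x p != 0 ->
  exists k : nat, v (pev emb x p) = v (x - emb c) *+ k.
Proof.
move=> h1 nz; have [k [q q0 pE]] := multiplicity_XsubC p c.
have p0 : p != 0 by apply: contraNneq nz => ->; rewrite rmorph0.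
move: q0 nz; rewrite p0 /= pE rmorphM rmorphXn /= pevXsubC mulf_eq0 negb_or.
move=> + /andP[nz1 nz2].
rewrite /root => qc0.
have hg : vge 1 (x - emb c) by apply/orP; right; lia.
have [_ e1] := place_pev_unit hg qc0.
exists k; rewrite placeM // e1 add0r.
have [->|k0] := posnP k; first by rewrite expr0 place1.
by rewrite placeX //; move: nz2; rewrite expf_eq0 k0.
Qed.

Lemma place_pev_pole x p : x != 0 -> v x < 0 -> p != 0 ->
  pev emb x p != 0 /\ v (pev emb x p) = v x *+ (size p).-1.
Proof.
move=> x0 hx; elim/poly_ind: p => [|p c IHp]; first by rewrite eqxx.
case: (eqVneq p 0) => [->|p0 _].
  rewrite mul0r add0r polyC_eq0 pevC fmorph_eq0 size_polyC => c0.
  by rewrite c0 place_emb // mulr0n.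
have [e0 e1] := IHp p0; rewrite rmorphD rmorphM /= pevX pevC.
have m0 : pev emb x p * x != 0 by rewrite mulf_neq0.
have sp : (0 < size p)%N by rewrite size_poly_gt0.
have vm : v (pev emb x p * x) = v x *+ (size p).
  by rewrite placeM // e1 -mulrSr prednK.
have [|-> ->] := @place_congr _ (pev emb x p * x + emb c) m0.
  rewrite addrAC subrr add0r; apply: vgeW (vge_emb c).
  have := mulrn_wle0 (size p).-1 (ltW hx).
  by rewrite vm -{2}(prednK sp) mulrS; lia.
by rewrite vm size_MXaddC (negPf p0) /=.
Qed.

End Place.

(** * Ramification *)

Lemma int_le_mulrn (a : int) (n : nat) : 0 < a -> n%:Z <= a *+ n.
Proof. by rewrite -mulr_natr natz; nia. Qed.

Lemma leq_ord_pred n (i : 'I_n) : (i <= n.-1)%N.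
Proof. by rewrite -ltnS prednK // (leq_trans _ (ltn_ord i)). Qed.

(* With [g = gcd(m, l)], [e = m / g], [l' = l / g], [a] and [vy] the values of
   the uniformizer below and of [y], the relation on values reads
   [m * vy = l * a]. *)
Lemma ram_values (e g l' : nat) (a vy : int) :
    (0 < g)%N -> (0 < e)%N -> coprime e l' -> 0 < a ->
    (e * g)%:Z * vy = (l' * g)%:Z * a ->
  exists b, [/\ 0 < b, a = b * e%:Z & vy = l'%:Z * b].
Proof.
move=> g0 e0 cop a0 h; have {}h : e%:Z * vy = l'%:Z * a by nia.
have /dvdzP[b bE] : (e%:Z %| a)%Z.
  rewrite -(Gauss_dvdzr (n := l'%:Z)); last by [].
  by rewrite -h dvdz_mulr.
by exists b; split=> //; nia.
Qed.

(** Since [l'] is invertible modulo [e], the class of i l' + k e determines i < e; so distinct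
    components y^i (...) of an expansion never share a value. *)
Lemma ram_inj (e l' i j : nat) (b k k' : int) :
    coprime e l' -> (i < e)%N -> (j < e)%N -> 0 < b ->
    (i%:Z * l'%:Z + k * e%:Z) * b = (j%:Z * l'%:Z + k' * e%:Z) * b -> i = j.
Proof.
move=> cop hi hj b0 /mulIf h.
have {}h : i%:Z * l'%:Z + k * e%:Z = j%:Z * l'%:Z + k' * e%:Z by apply: h; lia.
have : (e%:Z %| (i%:Z - j%:Z) * l'%:Z)%Z.
  by apply/dvdzP; exists (k' - k); lia.
rewrite Gauss_dvdzl // => /dvdzP[q hq]; have : q = 0 by nia.
by lia.
Qed.

(** * Truncated roots of power series *)

Section RootApproximation.
Variables (K : fieldType) (n : nat) (U : {poly K}) (w : K).

(** Hensel lifting of the root [w] of Z^n = U modulo X, one coefficient at a time: each new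
    coefficient cancels the leading error, and the divisor is the derivative n Z^(n-1) at [w]. *)
Fixpoint root_approx (N : nat) : {poly K} :=
  if N is N'.+1 then
    root_approx N' - ((root_approx N' ^+ n - U)`_N / (n%:R * w ^+ n.-1)) *: 'X^N
  else w%:P.

Lemma root_approx0 N : (root_approx N).[0] = w.
Proof.
elim: N => [|N IHN] /=; first by rewrite hornerC.
by rewrite hornerD hornerN hornerZ hornerXn expr0n mulr0 subr0.
Qed.

Lemma root_approxS N : 'X^(N.+1) %| root_approx N.+1 - root_approx N.
Proof. by rewrite /= addrAC subrr add0r dvdpNr -mul_polyC dvdp_mull. Qed.

Lemma dvdpX_horner0 (p : {poly K}) : ('X %| p) = (p.[0] == 0).
Proof. by rewrite -['X]subr0 dvdp_XsubCl. Qed.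

Hypotheses (n0 : n%:R != 0 :> K) (w0 : w != 0) (wn : w ^+ n = U.[0]).

Lemma root_approxP N : 'X^(N.+1) %| root_approx N ^+ n - U.
Proof.
elim: N => [|N IHN].
  rewrite expr1 dvdpX_horner0 /= hornerD hornerN horner_exp hornerC wn.
  by rewrite subrr.
rewrite /=; set W := root_approx N in IHN *; set c := _ / _; set d := _ *: _.
case/dvdpP: IHN => q hq.
have ne0 : n%:R * w ^+ n.-1 != 0 by rewrite mulf_neq0 // expf_neq0.
have d0 : d.[0] = 0 by rewrite hornerZ hornerXn expr0n mulr0.
have cE : c = q.[0] / (n%:R * w ^+ n.-1).
  by rewrite /c hq coefMXn ltnn subnn horner_coef0.
(* [S] is the cofactor in (W - d)^n - W^n = - d S. Its constant term n w^(n-1) is the denominator of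
   [c], so q - c S vanishes at 0 and one more power of X divides the error. *)
pose S := \sum_(i < n) (W - d) ^+ (n.-1 - i) * W ^+ i.
have -> : (W - d) ^+ n - U = (q - c *: S) * 'X^(N.+1).
  have -> : (W - d) ^+ n - U = ((W - d) ^+ n - W ^+ n) + (W ^+ n - U).
    by ring.
  by rewrite subrXX -/S hq /d mulrBl -!mul_polyC; ring.
rewrite (exprS _ N.+1) dvdp_mul // dvdpX_horner0 hornerD hornerN hornerZ horner_sum.
have -> : \sum_(i < n) ((W - d) ^+ (n.-1 - i) * W ^+ i).[0] =
    \sum_(i < n) w ^+ n.-1.
  apply: eq_bigr => i _; rewrite hornerM !horner_exp hornerD hornerN d0 subr0.
  by rewrite root_approx0 -exprD subnK // leq_ord_pred.
by rewrite sumr_const card_ord -[w ^+ _ *+ _]mulr_natl cE divfK // subrr.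
Qed.

End RootApproximation.

Section Ramification.
Variables (K : closedFieldType) (F : fieldType) (emb : {rmorphism K -> F}).
Variable (v : F -> int).
Hypothesis v_place : is_place emb v.

(** Terms of distinct values cannot cancel: a partial sum has the value of one of its terms, which
    differs from the value of the next term. *)
Lemma place_sum_distinct (I : eqType) (s : seq I) (f : I -> F) : uniq s ->
    (forall i j, f i != 0 -> f j != 0 -> v (f i) = v (f j) -> i = j) ->
    \sum_(i <- s) f i != 0 ->
  exists i, [/\ i \in s, f i != 0 & v (\sum_(j <- s) f j) = v (f i)].
Proof.
move=> us inj; elim: s us => [|i s IHs] /=; first by rewrite big_nil eqxx.
move=> /andP[is_ us]; rewrite big_cons; set S := \sum_(j <- s) _ in IHs *.
case: (eqVneq S 0) => [->|S0]; first by rewrite addr0; exists i; rewrite mem_head.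
have [j [js fj vj]] := IHs us S0.
case: (eqVneq (f i) 0) => [->|fi].
  by rewrite add0r => _; exists j; rewrite inE js orbT.
move=> _; case: (ltgtP (v (f i)) (v S)) => h.
- exists i; split; rewrite ?mem_head //.
  have [|//] := place_congr v_place (b := f i + S) fi.
  by rewrite addrAC subrr add0r (vgeP _ _ S0); lia.
- exists j; split; rewrite ?inE ?js ?orbT // -vj.
  have [|//] := place_congr v_place (b := f i + S) S0.
  by rewrite addrK (vgeP _ _ fi); lia.
- by rewrite vj in h; move: is_; rewrite (inj _ _ fi fj h) js.
Qed.

Variable t : F.
Hypotheses (vt : 0 < v t) (t0 : t != 0).

Let vge_t : vge v 1 t. Proof. by apply/orP; right; lia. Qed.
Let vge_t0 : vge v 1 (t - emb 0). Proof. by rewrite rmorph0 subr0. Qed.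
Let vge0_t : vge v 0 t. Proof. by apply: vgeW vge_t. Qed.

Lemma vge_pev2_sub n a b Q : vge v 0 a -> vge v 0 b -> vge v n (a - b) ->
  vge v n (pev2 emb t a Q - pev2 emb t b Q).
Proof.
move=> ha hb hab.
have hQ Q' : vge v 0 (pev2 emb t a Q').
  elim/poly_ind: Q' => [|q c IHq]; first by rewrite rmorph0 vge0.
  rewrite rmorphD rmorphM /= pev2C pev2X (vgeD v_place) //; last exact: vge_pev.
  by rewrite -[0]addr0 (vgeM v_place).
elim/poly_ind: Q => [|q c IHq]; first by rewrite !rmorph0 subrr vge0.
rewrite !rmorphD !rmorphM /= !pev2C !pev2X.
set A := pev2 _ _ a q; set B := pev2 _ _ b q; set C := pev _ _ _.
have -> : A * a + C - (B * b + C) = A * (a - b) + (A - B) * b by ring.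
apply: (vgeD v_place); first by rewrite -[n]add0r (vgeM v_place) ?hQ.
by rewrite -[n]addr0 (vgeM v_place).
Qed.

Variables (g : nat) (U : {poly K}) (w : F).
Hypotheses (g0 : g%:R != 0 :> K) (U0 : U.[0] != 0) (wg : w ^+ g = pev emb t U).

Let g_gt0 : (0 < g)%N. Proof. by case: g g0 => //; rewrite eqxx. Qed.

(** The polynomial X^g - U(0) splits over K and is zero or of positive value at [w]; hence so is one
    of its factors w - c. *)
Lemma residue_root : exists c, c ^+ g = U.[0] /\ vge v 1 (w - emb c).
Proof.
pose p := 'X^g - U.[0]%:P.
have mp : p \is monic by rewrite monicXnsubC.
have [r] := closed_field_poly_normal p; rewrite (monicP mp) scale1r => pE.
have hw : vge v 1 (pev emb w p).
  rewrite rmorphB rmorphXn /= pevX pevC wg; exact: (vge_pev_sub v_place).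
have [/hasP[c cr hc]|no] := boolP (has (fun c => vge v 1 (w - emb c)) r).
  exists c; split=> //; have : root p c by rewrite pE root_prod_XsubC.
  by rewrite /root hornerD hornerN hornerXn hornerC subr_eq0 => /eqP.
suff [nz le0] : pev emb w p != 0 /\ v (pev emb w p) <= 0.
  by move: hw; rewrite (vgeP _ _ nz) => /le_trans/(_ le0).
rewrite pE rmorph_prod /=; elim: r no {pE} => [|c r IHr] /=.
  by rewrite big_nil oner_eq0 (place1 v_place).
rewrite negb_or /vge negb_or -andbA => /and3P[nz lt /IHr[nz' lt']].
rewrite big_cons pevXsubC mulf_neq0 // (placeM v_place) //; split=> //.
by rewrite -[0]addr0 lerD //; move: lt; rewrite -ltNge -[1]add0r ltzD1.
Qed.

(** With s the truncated root, w^g - s^g = (w - s) T, where T is a unit of residue g c^(g-1); the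
    whole order of w^g - s^g therefore falls on w - s. *)
Lemma root_approx_place c N : c ^+ g = U.[0] -> vge v 1 (w - emb c) ->
  vge v N.+1%:Z (w - pev emb t (root_approx g U c N)).
Proof.
move=> cg hw; set S := root_approx _ _ _ _; set s := pev _ _ S.
have c0 : c != 0.
  by apply: contraNneq U0 => c0; rewrite -cg c0 expr0n eqn0Ngt g_gt0.
have hs : vge v 1 (s - emb c).
  by rewrite -[c in emb c](root_approx0 g U c N); apply: (vge_pev_sub v_place).
have hs0 : vge v 0 s by apply: (vge_subC v_place (c := c)); apply: vgeW hs.
have powsub a n : vge v 1 (a - emb c) -> vge v 1 (a ^+ n - emb c ^+ n).
  move=> /(vge_pev_sub v_place 'X^n).
  by rewrite rmorphXn /= pevX hornerXn rmorphXn.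
pose T := \sum_(i < g) w ^+ (g.-1 - i) * s ^+ i.
have c1 : emb (g%:R * c ^+ g.-1) != 0.
  by rewrite fmorph_eq0 mulf_neq0 // expf_neq0.
have [|T0 vT] := place_congr v_place (b := T) c1.
  rewrite (place_emb v_place) ?add0r; last by move: c1; rewrite fmorph_eq0.
  have -> : emb (g%:R * c ^+ g.-1) =
      \sum_(i < g) emb c ^+ (g.-1 - i) * emb c ^+ i.
    rewrite mulr_natl rmorphMn rmorphXn /= -[g in _ *+ g]card_ord -sumr_const.
    by apply: eq_bigr => i _; rewrite -exprD subnK // leq_ord_pred.
  rewrite -sumrB; apply: (vge_sum v_place) => i _; set a := (_ - _)%N.
  have -> : w ^+ a * s ^+ i - emb c ^+ a * emb c ^+ i =
    (w ^+ a - emb c ^+ a) * s ^+ i + emb c ^+ a * (s ^+ i - emb c ^+ i).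
    by ring.
  apply: (vgeD v_place).
    by rewrite -[1]addr0 (vgeM v_place) ?(vge0X v_place) ?powsub.
  by rewrite -[1]add0r (vgeM v_place) ?(vge0X v_place) ?(vge_emb v_place) ?powsub.
have hT : vge v N.+1%:Z ((w - s) * T).
  rewrite -subrXX wg /s -rmorphXn -rmorphB /=.
  have : 'X^(N.+1) %| U - S ^+ g.
    by rewrite -opprB dvdpNr; apply: root_approxP.
  case/dvdpP => q ->; rewrite rmorphM rmorphXn /= pevX -[N.+1%:Z]add0r.
  rewrite (vgeM v_place) ?(vge_pev v_place) // vgeP ?expf_neq0 //.
  by rewrite (placeX v_place) //; apply: int_le_mulrn.
rewrite /vge; case: eqVneq hT => //= ws0; rewrite vgeP ?mulf_neq0 //.
by rewrite (placeM v_place) // vT (place_emb v_place) ?addr0 // -(fmorph_eq0 emb).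
Qed.

(** To any given order [w] agrees with a polynomial in [t], so elements of K[t, w] have the same
    values as polynomials in [t]: adjoining [w] causes no ramification. *)
Lemma place_pev2_unramified Q : pev2 emb t w Q != 0 ->
  exists k : nat, v (pev2 emb t w Q) = v t *+ k.
Proof.
move=> nz; have [c [cg hc]] := residue_root.
(* The truncation is accurate to order N + 1, beyond the value of Q(t, w), which therefore survives
   the replacement of [w]. *)
pose N := `|v (pev2 emb t w Q)|%N.
pose s := pev emb t (root_approx g U c N).
have hws := root_approx_place N cg hc.
have hw0 : vge v 0 w by apply: (vge_subC v_place (c := c)); apply: vgeW hc.
have hs0 : vge v 0 s by apply: vge_pev.
have [|nz' <-] := place_congr v_place (b := pev2 emb t s Q) nz.
  apply: (@vgeW _ _ N.+1%:Z); first by rewrite -addn1 PoszD lerD2r lez_abs.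
  apply: vge_pev2_sub => //; rewrite -opprB; exact: (vgeN v_place).
have sE : pev2 emb t s Q = pev emb t Q.[root_approx g U c N].
  by rewrite pev2E horner_map.
rewrite sE in nz' *; have := place_pev_order v_place (x := t) (c := 0).
by rewrite rmorph0 subr0; apply.
Qed.

End Ramification.

(** Powers of [y] are grouped by exponent modulo [e] and each y^e is traded for t^l w. This isolates
    the ramified part, carried by y^i with i < e, from K[t, w]. *)
Lemma pev2_split_mod (K F : fieldType) (emb : {rmorphism K -> F}) (t y w : F)
    (e l : nat) (P : {poly {poly K}}) :
    (0 < e)%N -> y ^+ e = t ^+ l * w ->
  exists Q : 'I_e -> {poly {poly K}},
    pev2 emb t y P = \sum_(i < e) y ^+ i * pev2 emb t w (Q i).
Proof.
move=> e0 ye.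
exists (fun i : 'I_e => \sum_(k < size P | (k %% e)%N == i)
  (P`_k * 'X^(l * (k %/ e)))%:P * 'X^(k %/ e)).
rewrite pev2_sum (partition_big (fun k : 'I__ => Ordinal (ltn_pmod k e0)) xpredT) //=.
apply: eq_bigr => i _; rewrite rmorph_sum mulr_sumr /=.
apply: eq_big => k; first by rewrite -val_eqE.
move=> /eqP <- /=; rewrite !rmorphM !rmorphXn /= pev2X !pev2C pevX.
have -> : y ^+ k = y ^+ (k %% e) * (t ^+ (l * (k %/ e)) * w ^+ (k %/ e)).
  by rewrite {1}(divn_eq k e) exprD mulnC exprM ye exprMn -exprM mulrC.
by rewrite mulrCA -!mulrA.
Qed.

(** Write e = m / gcd(m, l) and v(t) = b e. The components y^i (...) of an element of K[t, y] have
    values that are multiples of b, in distinct classes modulo b e, so the value of their sum is one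
    of them. As F contains an element of value 1, b = 1. *)
Theorem ramification_index (K : closedFieldType) (F : fieldType)
    (emb : {rmorphism K -> F}) (v : F -> int) (m l : nat) (U : {poly K})
    (t y : F) :
    is_place emb v -> 0 < v t -> t != 0 -> m%:R != 0 :> K -> U.[0] != 0 ->
    y ^+ m = t ^+ l * pev emb t U ->
    (forall z, exists d P, pev emb t d != 0 /\ z * pev emb t d = pev2 emb t y P) ->
  (gcdn m l)%:Z * v t = m%:Z.
Proof.
move=> v_place vt t0 mK U0 ym span.
have m0 : (0 < m)%N by case: m mK {ym} => //; rewrite eqxx.
have tE : t = t - emb 0 by rewrite rmorph0 subr0.
have [Ut0 vU] : pev emb t U != 0 /\ v (pev emb t U) = 0.
  apply: (place_pev_unit v_place (c := 0)) => //.
  by rewrite -tE; apply/orP; right; lia.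
have y0 : y != 0.
  have : y ^+ m != 0 by rewrite ym mulf_neq0 // expf_neq0.
  by rewrite expf_eq0 m0.
set g := gcdn m l; have g0 : (0 < g)%N by rewrite gcdn_gt0 m0.
pose e := (m %/ g)%N; pose l' := (l %/ g)%N.
have mE : m = (e * g)%N by rewrite divnK // dvdn_gcdl.
have lE : l = (l' * g)%N by rewrite divnK // dvdn_gcdr.
have e0 : (0 < e)%N by rewrite divn_gt0 // dvdn_leq // dvdn_gcdl.
have cop : coprime e l'.
  have : gcdn m l = g by []; rewrite {1}mE lE -muln_gcdl /coprime => h.
  by rewrite -(eqn_pmul2r g0) h mul1n.
have gK : g%:R != 0 :> K by apply: contraNneq mK; rewrite mE natrM => ->; rewrite mulr0.
have vy : m%:Z * v y = l%:Z * v t.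
  have := congr1 v ym; rewrite (placeM v_place) ?expf_neq0 // vU addr0.
  by rewrite !(placeX v_place) // -!(mulr_natr (v _)) !natz mulrC => ->; rewrite mulrC.
have [b [b0 bE vyb]] : exists b, [/\ 0 < b, v t = b * e%:Z & v y = l'%:Z * b].
  by apply: ram_values g0 e0 cop vt _; rewrite -mE -lE.
(* The unit part of y^e: it satisfies w^g = U(t) with U(0) != 0, the unramified situation. *)
pose w := y ^+ e / t ^+ l'.
have ye : y ^+ e = t ^+ l' * w by rewrite mulrC divfK // expf_neq0.
have wg : w ^+ g = pev emb t U.
  by rewrite exprMn exprVn -!exprM -mE -lE ym mulrAC mulfV ?mul1r // expf_neq0.
have [z [z0 vz]] : exists z, z != 0 /\ v z = 1 by case: v_place.
have [d [P [d0 zd]]] := span z.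
have [Q PE] := pev2_split_mod emb P e0 ye.
have [kd vd] : exists k : nat, v (pev emb t d) = v t *+ k.
  by have := place_pev_order v_place (x := t) (c := 0); rewrite -tE; apply.
have unr := place_pev2_unramified v_place vt t0 gK U0 wg.
have vterm (i : 'I_e) : y ^+ i * pev2 emb t w (Q i) != 0 ->
    exists k : nat, v (y ^+ i * pev2 emb t w (Q i)) = (i%:Z * l'%:Z + k%:Z * e%:Z) * b.
  rewrite mulf_eq0 negb_or => /andP[nz1 nz2]; have [k hk] := unr _ nz2.
  exists k; rewrite (placeM v_place) // hk (placeX v_place) // vyb bE.
  by rewrite -(mulr_natr (_ * _)) -(mulr_natr (b * _)) !natz; ring.
have nz : \sum_(i < e) y ^+ i * pev2 emb t w (Q i) != 0.
  by rewrite -PE -zd mulf_neq0.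
have [|i [_ nzi]] := place_sum_distinct v_place (index_enum_uniq _) _ nz.
  move=> i j /vterm[k ->] /vterm[k' ->] h; apply: val_inj => /=.
  exact: ram_inj cop (ltn_ord i) (ltn_ord j) b0 h.
have [k ->] := vterm _ nzi.
rewrite -PE -zd (placeM v_place) // vz vd bE -mulr_natr natz => h.
have b1 : (b %| 1)%Z.
  apply/dvdzP; exists (i%:Z * l'%:Z + k%:Z * e%:Z - e%:Z * kd%:Z).
  by rewrite mulrBl -h; ring.
have -> : b = 1 by move: b1 b0; rewrite dvdz1; clear; lia.
by rewrite mul1r mulrC -PoszM -mE.
Qed.

(** * Existence of places *)

Section OrderAtZero.
Variable K : fieldType.
Implicit Types p q : {poly K}.

Definition has_ord p n := exists2 a, p = a * 'X^n & a.[0] != 0.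

Lemma has_ordM p q n k : has_ord p n -> has_ord q k -> has_ord (p * q) (n + k).
Proof.
move=> [a -> a0] [b -> b0]; exists (a * b); last by rewrite hornerM mulf_neq0.
by rewrite exprD mulrACA.
Qed.

Lemma has_ord_congr p q n :
  has_ord p n -> 'X^(n.+1) %| q - p -> has_ord q n.
Proof.
move=> [a pE a0] /dvdpP[b qE]; exists (b * 'X + a).
  by rewrite mulrDl -pE -mulrA -exprS -qE subrK.
by rewrite hornerD hornerM hornerX mulr0 add0r.
Qed.

Lemma has_ord_ex p : p != 0 -> exists n, has_ord p n.
Proof.
move=> p0; have [n [q]] := multiplicity_XsubC p 0.
by rewrite p0 /= subr0 => q0 pE; exists n, q.
Qed.

Lemma has_ord_dvd p n k : has_ord p n -> 'X^k %| p -> (k <= n)%N.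
Proof.
move=> [a -> a0]; apply: contraTleq => nk.
have Xn : 'X^n != 0 :> {poly K} by rewrite expf_neq0 // polyX_eq0.
rewrite -(subnK (ltnW nk)) exprD dvdp_mul2r //.
apply: contra a0 => h; rewrite -dvdpX_horner0; apply: dvdp_trans h.
by rewrite -[X in X %| _]expr1 dvdp_exp2l // subn_gt0.
Qed.

Lemma has_ord_uniq p n k : has_ord p n -> has_ord p k -> n = k.
Proof.
move=> hn hk; apply/eqP; rewrite eqn_leq (has_ord_dvd hk) ?(has_ord_dvd hn) //.
  by case: hk => a -> _; rewrite dvdp_mull.
by case: hn => a -> _; rewrite dvdp_mull.
Qed.

End OrderAtZero.

Definition subst2 (K : fieldType) (q c : {poly K}) :
  {poly {poly K}} -> {poly K} := horner_eval c \o map_poly (comp_poly q).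
HB.instance Definition _ K q c :=
  GRing.RMorphism.copy (@subst2 K q c) (horner_eval c \o map_poly (comp_poly q)).

Lemma pev2_XnsubC (K F : fieldType) (emb : {rmorphism K -> F}) (x y : F) n p :
  pev2 emb x y ('X^n - p%:P) = y ^+ n - pev emb x p.
Proof. by rewrite raddfB /= rmorphXn /= pev2X pev2C. Qed.

Lemma subst2X (K : fieldType) (q c : {poly K}) : subst2 q c 'X = c.
Proof. by rewrite /subst2 /= /horner_eval map_polyX hornerX. Qed.

Lemma subst2C (K : fieldType) (q c a : {poly K}) : subst2 q c a%:P = a \Po q.
Proof. by rewrite /subst2 /= /horner_eval map_polyC hornerC. Qed.

Lemma subst2_XnsubC (K : fieldType) (q c a : {poly K}) n :
  subst2 q c ('X^n - a%:P) = c ^+ n - (a \Po q).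
Proof. by rewrite raddfB /= rmorphXn /= subst2X subst2C. Qed.

Section ExistsPlace.
Variables (K : closedFieldType) (F : fieldType) (emb : {rmorphism K -> F}).
Variables (m l : nat) (U : {poly K}) (t y : F).
Hypotheses (mK : m%:R != 0 :> K) (U0 : U.[0] != 0).
Hypothesis tr : transcendental emb t.
Hypothesis ym : y ^+ m = t ^+ l * pev emb t U.
Hypothesis span : forall z, exists d P,
  pev emb t d != 0 /\ z * pev emb t d = pev2 emb t y P.
Hypothesis indep : forall P : {poly {poly K}},
  (size P <= m)%N -> pev2 emb t y P = 0 -> P = 0.

Let m0 : (0 < m)%N. Proof. by case: m mK => //; rewrite eqxx. Qed.

Let A : {poly {poly K}} := 'X^m - ('X^l * U)%:P.

(** Division by the monic [A] leaves a remainder of degree below m, which independence kills. Hence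
    a substitution sending [A] to 0 modulo X^N is well defined on K[t, y] modulo X^N. *)
Lemma pev2_kernel P : pev2 emb t y P = 0 -> exists R, P = R * A.
Proof.
have mA : A \is monic by rewrite monicXnsubC.
move=> P0; rewrite (Pdiv.RingMonic.rdivp_eq mA P); set R := Pdiv.Ring.rdivp _ _.
exists R; suff -> : Pdiv.Ring.rmodp P A = 0 by rewrite addr0.
apply: indep.
  rewrite -ltnS -(size_XnsubC ('X^l * U) m0).
  by rewrite Pdiv.Ring.ltn_rmodpN0 ?monic_neq0.
move: P0; rewrite {1}(Pdiv.RingMonic.rdivp_eq mA P) rmorphD rmorphM /= => <-.
rewrite (_ : pev2 _ _ _ A = 0) ?mulr0 ?add0r // pev2_XnsubC ym.
by rewrite rmorphM rmorphXn /= pevX subrr.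
Qed.

Let g := gcdn m l.
Let e := (m %/ g)%N.
Let l' := (l %/ g)%N.

Let g0 : (0 < g)%N. Proof. by rewrite gcdn_gt0 m0. Qed.
Let e0 : (0 < e)%N. Proof. by rewrite divn_gt0 // dvdn_leq // dvdn_gcdl. Qed.
Let mE : m = (e * g)%N. Proof. by rewrite divnK // dvdn_gcdl. Qed.
Let lE : l = (l' * g)%N. Proof. by rewrite divnK // dvdn_gcdr. Qed.

Variable w : K.
Hypothesis wm : w ^+ m = U.[0].

Let w0 : w != 0.
Proof. by apply: contraNneq U0 => w0; rewrite -wm w0 expr0n eqn0Ngt m0. Qed.

(* The image of [y] up to order [N] under [t |-> 'X^e]; the limit embeds [F] in
   the field of Laurent series. *)
Let c N : {poly K} := 'X^l' * (root_approx m U w N \Po 'X^e).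

Local Notation ev N := (subst2 'X^e (c N)).

Let dvdp_compXn n (p : {poly K}) : 'X^n %| p -> 'X^n %| p \Po 'X^e.
Proof.
move/dvdpP=> [q ->]; rewrite comp_polyM rmorphXn /= comp_polyX -exprM.
by rewrite dvdp_mull // dvdp_exp2l // leq_pmull.
Qed.

(** Because l' m = e l, the power of X factors out of y^m - t^l U and leaves the error of the
    truncated root. *)
Lemma subst2_relation N : 'X^N %| ev N A.
Proof.
rewrite [ev N A]subst2_XnsubC.
have -> : c N ^+ m - (('X^l * U) \Po 'X^e) =
    'X^(l' * m) * ((root_approx m U w N ^+ m - U) \Po 'X^e).
  rewrite comp_polyM rmorphXn /= comp_polyX comp_polyB rmorphXn /= exprMn.
  rewrite -!exprM mulrBr; congr (_ - 'X^_ * _).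
  by rewrite [X in (_ * X)%N = _]lE [X in _ = (_ * X)%N]mE mulnCA.
rewrite dvdp_mull // dvdp_compXn //.
by apply: dvdp_trans (root_approxP mK w0 wm N); rewrite dvdp_exp2l.
Qed.

Lemma subst2_stepS N P : 'X^N %| ev N.+1 P - ev N P.
Proof.
have hc : 'X^N %| c N.+1 - c N.
  rewrite -mulrBr dvdp_mull // -comp_polyB dvdp_compXn //.
  by apply: dvdp_trans (root_approxS m U w N); rewrite dvdp_exp2l.
elim/poly_ind: P => [|P a IHP]; first by rewrite !rmorph0 subrr dvdp0.
rewrite !rmorphD !rmorphM /= !subst2X !subst2C.
have -> (p p' q q' s : {poly K}) :
  p * q + s - (p' * q' + s) = p * (q - q') + (p - p') * q' by ring.
by rewrite dvdp_add //; [rewrite dvdp_mull|rewrite dvdp_mulr].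
Qed.

Lemma subst2_step N M P : (N <= M)%N -> 'X^N %| ev M P - ev N P.
Proof.
move=> NM; rewrite -(subnK NM); elim: (M - N)%N => [|k IHk].
  by rewrite subrr dvdp0.
rewrite addSn -(subrK (ev (k + N) P) (ev _.+1 P)) -addrA dvdp_add //.
by apply: dvdp_trans (subst2_stepS _ P); rewrite dvdp_exp2l // leq_addl.
Qed.

(** The order in X of the power series whose truncations are the [ev N P]. Successive images agree
    modulo X^N, so every truncation beyond n shows it and the series itself need not be formed. *)
Definition lim_ord P n := forall N, (n < N)%N -> has_ord (ev N P) n.

Lemma lim_ord_of P n N : (n < N)%N -> has_ord (ev N P) n -> lim_ord P n.
Proof.
move=> nN h M nM; apply: has_ord_congr h _.
case: (leqP N M) => [NM|/ltnW MN].
  by apply: dvdp_trans (subst2_step _ NM); rewrite dvdp_exp2l.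
rewrite -opprB dvdpNr; apply: dvdp_trans (subst2_step _ MN).
by rewrite dvdp_exp2l.
Qed.

(** Two representatives differ by a multiple of [A], whose image vanishes modulo X^N: the order
    belongs to the element of F and not to the polynomial. *)
Lemma lim_ord_eval P Q n :
  pev2 emb t y P = pev2 emb t y Q -> lim_ord P n -> lim_ord Q n.
Proof.
move=> PQ hP N nN; apply: has_ord_congr (hP N nN) _.
have [|R hR] := @pev2_kernel (Q - P); first by rewrite raddfB /= PQ subrr.
rewrite -raddfB /= hR rmorphM /= dvdp_mull //.
by apply: dvdp_trans (subst2_relation N); rewrite dvdp_exp2l.
Qed.

Lemma lim_ordM P Q n k : lim_ord P n -> lim_ord Q k -> lim_ord (P * Q) (n + k).
Proof.
move=> hP hQ N hN; rewrite rmorphM /=; apply: has_ordM.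
  by apply: hP; apply: leq_ltn_trans hN; apply: leq_addr.
by apply: hQ; apply: leq_ltn_trans hN; apply: leq_addl.
Qed.

Lemma lim_ordD P Q n k j :
  lim_ord P n -> lim_ord Q k -> lim_ord (P + Q) j -> (minn n k <= j)%N.
Proof.
move=> hP hQ hPQ; pose N := (n + k + j).+1.
have nN : (n < N)%N by rewrite ltnS -addnA leq_addr.
have kN : (k < N)%N by rewrite ltnS addnAC leq_addl.
have jN : (j < N)%N by rewrite ltnS leq_addl.
apply: has_ord_dvd (hPQ N jN) _; rewrite rmorphD /= dvdp_add //.
  by have [a -> _] := hP N nN; rewrite dvdp_mull // dvdp_exp2l // geq_minl.
by have [a -> _] := hQ N kN; rewrite dvdp_mull // dvdp_exp2l // geq_minr.
Qed.

Lemma lim_ord_uniq P n k : lim_ord P n -> lim_ord P k -> n = k.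
Proof.
move=> hn hk; apply: has_ord_uniq (hn (n + k).+1 _) (hk (n + k).+1 _).
  by rewrite ltnS leq_addr.
by rewrite ltnS leq_addl.
Qed.

(** Injectivity of the embedding in Laurent series. The inverse of a nonzero element is some Q / d,
    so the image of P Q agrees with the nonzero polynomial d(X^e) to high order; the order of P
    cannot exceed that of d(X^e). *)
Lemma lim_ord_ex P : pev2 emb t y P != 0 -> exists n, lim_ord P n.
Proof.
move=> P0; have [d [Q [d0 hQ]]] := span (pev2 emb t y P)^-1.
have [|R hR] := @pev2_kernel (d%:P - P * Q).
  by rewrite raddfB /= rmorphM /= pev2C -hQ mulrA mulfV // mul1r subrr.
have [mu hmu] : exists n, has_ord (d \Po 'X^e) n.
  apply: has_ord_ex; rewrite comp_poly_eq0 ?size_polyXn ?ltnS //.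
  by apply: contraNneq d0 => ->; rewrite rmorph0.
have hPQ : has_ord (ev mu.+1 P * ev mu.+1 Q) mu.
  apply: has_ord_congr hmu _; rewrite -(subst2C _ (c mu.+1)) -rmorphM /= -raddfB /=.
  by rewrite -opprB raddfN /= dvdpNr hR rmorphM /= dvdp_mull // subst2_relation.
have [|n hn] := @has_ord_ex _ (ev mu.+1 P).
  apply/eqP => h; case: hPQ => a; rewrite h mul0r => /esym/eqP.
  rewrite mulf_eq0 expf_eq0 polyX_eq0 andbF orbF => /eqP ->.
  by rewrite horner0 eqxx.
exists n; apply: (lim_ord_of _ hn); rewrite ltnS; apply: has_ord_dvd hPQ _.
by case: hn => a -> _; rewrite -mulrAC dvdp_mull.
Qed.

(** The value of a quotient, kept as a relation because representatives are only known to exist; a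
    function is chosen once uniqueness is available. *)
Definition val_rel z (j : int) := exists P Q n k,
  [/\ pev2 emb t y Q != 0, pev2 emb t y P = z * pev2 emb t y Q,
      lim_ord P n, lim_ord Q k & j = n%:Z - k%:Z].

Lemma val_rel_ex z : z != 0 -> exists j, val_rel z j.
Proof.
move=> z0; have [d [P [d0 hP]]] := span z.
have [n hn] : exists n, lim_ord P n by apply: lim_ord_ex; rewrite -hP mulf_neq0.
have [k hk] : exists k, lim_ord d%:P k by apply: lim_ord_ex; rewrite pev2C.
by exists (n%:Z - k%:Z), P, d%:P, n, k; rewrite pev2C.
Qed.

Lemma val_rel_uniq z i j : val_rel z i -> val_rel z j -> i = j.
Proof.
move=> [P [Q [n [k [Q0 PE hP hQ ->]]]]] [P' [Q' [n' [k' [Q0' PE' hP' hQ' ->]]]]].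
suff : (n + k' = n' + k)%N by clear; lia.
apply: lim_ord_uniq (lim_ordM hP' hQ).
apply: lim_ord_eval (lim_ordM hP hQ').
by rewrite !rmorphM /= PE PE' mulrAC.
Qed.

Lemma val_relM z z' i j :
  val_rel z i -> val_rel z' j -> val_rel (z * z') (i + j).
Proof.
move=> [P [Q [n [k [Q0 PE hP hQ ->]]]]] [P' [Q' [n' [k' [Q0' PE' hP' hQ' ->]]]]].
exists (P * P'), (Q * Q'), (n + n')%N, (k + k')%N.
split; [|rewrite !rmorphM /= PE PE' mulrACA //|exact: lim_ordM
  |exact: lim_ordM|by clear; lia].
by rewrite rmorphM mulf_neq0.
Qed.

Lemma val_relD z z' i j h : z + z' != 0 ->
  val_rel z i -> val_rel z' j -> val_rel (z + z') h -> Num.min i j <= h.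
Proof.
move=> zz0 [P [Q [n [k [Q0 PE hP hQ iE]]]]].
move=> [P' [Q' [n' [k' [Q0' PE' hP' hQ' jE]]]]] hh.
have sE : pev2 emb t y (P * Q' + P' * Q) = (z + z') * pev2 emb t y (Q * Q').
  by rewrite rmorphD !rmorphM /= PE PE'; ring.
have QQ0 : pev2 emb t y (Q * Q') != 0 by rewrite rmorphM mulf_neq0.
have [a ha] : exists a, lim_ord (P * Q' + P' * Q) a.
  by apply: lim_ord_ex; rewrite sE mulf_neq0.
have hE : h = a%:Z - (k + k')%N%:Z.
  apply: val_rel_uniq hh _; exists (P * Q' + P' * Q), (Q * Q'), a, (k + k')%N.
  by split=> //; apply: lim_ordM.
have := lim_ordD (lim_ordM hP hQ') (lim_ordM hP' hQ) ha.
by rewrite hE iE jE; clear; lia.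
Qed.

Lemma lim_ord1 : lim_ord 1 0.
Proof.
move=> N _; rewrite rmorph1; exists 1; rewrite ?expr0 ?mulr1 //.
by rewrite hornerC oner_eq0.
Qed.

Lemma val_rel_pev2 P n : lim_ord P n -> val_rel (pev2 emb t y P) n%:Z.
Proof.
move=> h; exists P, 1, n, 0%N; rewrite subr0 rmorph1 mulr1.
by split=> //; [rewrite oner_eq0|exact: lim_ord1].
Qed.

Lemma val_rel_t : val_rel t e%:Z.
Proof.
rewrite -{1}(pevX emb t) -(pev2C emb t y); apply: val_rel_pev2 => N _.
rewrite subst2C comp_polyX; exists 1; first by rewrite mul1r.
by rewrite hornerC oner_eq0.
Qed.

Lemma val_rel_y : val_rel y l'%:Z.
Proof.
rewrite -{1}(pev2X emb t y); apply: val_rel_pev2 => N _.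
rewrite subst2X /c mulrC; exists (root_approx m U w N \Po 'X^e) => //.
by rewrite horner_comp hornerXn expr0n eqn0Ngt e0 root_approx0.
Qed.

Lemma val_rel_emb a : a != 0 -> val_rel (emb a) 0.
Proof.
move=> a0; rewrite -(pevC emb t) -(pev2C emb t y); apply: (@val_rel_pev2 _ 0%N).
by move=> N _; rewrite subst2C comp_polyC; exists a%:P; rewrite ?mulr1 ?hornerC.
Qed.

Lemma exists_place_root : exists v, is_place emb v /\ 0 < v t.
Proof.
have [v hv] : exists v : F -> int, forall z, z != 0 -> val_rel z (v z).
  apply: (functional_choice (fun z j => z != 0 -> val_rel z j)) => z.
  case: (eqVneq z 0) => [->|z0]; first by exists 0.
  by have [j] := val_rel_ex z0; exists j.
have t0 : t != 0 by have := transcendental_subC_neq0 0 tr; rewrite rmorph0 subr0.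
have y0 : y != 0.
  have : y ^+ m != 0.
    rewrite ym mulf_neq0 ?expf_neq0 // pev_eq0 //.
    by apply: contraNneq U0 => ->; rewrite horner0.
  by rewrite expf_eq0 m0.
have vt : v t = e%:Z by apply: val_rel_uniq (hv _ t0) val_rel_t.
have vy : v y = l'%:Z by apply: val_rel_uniq (hv _ y0) val_rel_y.
have vM a b : a != 0 -> b != 0 -> v (a * b) = v a + v b.
  move=> a0 b0; apply: val_rel_uniq (hv _ _) _; first by rewrite mulf_neq0.
  by apply: val_relM; apply: hv.
have vX a n : a != 0 -> v (a ^+ n) = v a * n%:Z.
  move=> a0; elim: n => [|n IHn].
    rewrite expr0 mulr0; apply: val_rel_uniq (hv _ (oner_neq0 _)) _.
    by rewrite -(rmorph1 emb); apply: val_rel_emb; rewrite oner_eq0.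
  by rewrite exprS vM ?expf_neq0 // IHn -addn1 PoszD mulrDr mulr1 addrC.
exists v; split; last by rewrite vt ltz_nat.
split=> // [a b a0 b0 ab0|a a0|].
- exact: val_relD (hv _ a0) (hv _ b0) (hv _ ab0).
- by apply: val_rel_uniq (hv _ _) (val_rel_emb a0); rewrite fmorph_eq0.
have cop : gcdn e l' = 1%N.
  apply/eqP; rewrite -(eqn_pmul2r g0) mul1n muln_gcdl -mE -lE; exact: eqxx.
(* Normalization: with v(t) = e and v(y) = l' coprime, Bezout gives 1 + a l' = q e, so t^q / y^a has
   value 1. *)
have [a _] := Bezoutl l' e0; rewrite cop => /dvdnP[q hq].
have nz : t ^+ q / y ^+ a != 0 by rewrite mulf_neq0 ?invr_eq0 ?expf_neq0.
exists (t ^+ q / y ^+ a); split=> //.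
have := vM _ _ nz (expf_neq0 a y0); rewrite divfK ?expf_neq0 // !vX // vt vy.
by move: hq; clear; nia.
Qed.

End ExistsPlace.

Theorem exists_place (K : closedFieldType) (F : fieldType)
    (emb : {rmorphism K -> F}) (m l : nat) (U : {poly K}) (t y : F) :
    m%:R != 0 :> K -> U.[0] != 0 -> transcendental emb t ->
    y ^+ m = t ^+ l * pev emb t U ->
    (forall z, exists d P,
      pev emb t d != 0 /\ z * pev emb t d = pev2 emb t y P) ->
    (forall P : {poly {poly K}},
      (size P <= m)%N -> pev2 emb t y P = 0 -> P = 0) ->
  exists v, is_place emb v /\ 0 < v t.
Proof.
move=> mK U0 tr ym span indep.
have m0 : (0 < m)%N by case: m mK {ym indep} => //; rewrite eqxx.
have /closed_rootP[w] : size ('X^m - U.[0]%:P) != 1%N.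
  by rewrite size_XnsubC // eqSS -lt0n.
rewrite /root hornerD hornerN hornerXn hornerC subr_eq0 => /eqP wm.
exact: (exists_place_root mK U0 tr ym span indep wm).
Qed.

(** * Kummer extensions *)

Local Notation tofrac := (@FracField.tofrac _).

Lemma fraction_ex (R : idomainType) (q : {fraction R}) :
  exists nd : R * R, (nd.2 != 0) && (q * tofrac nd.2 == tofrac nd.1).
Proof.
elim/quotW: q => r; exists (frac r).
rewrite denom_ratioP /=; apply/eqP; unlock FracField.tofrac.
rewrite -[LHS]FracField.pi_mul; apply/eqmodP.
rewrite /= FracField.equivfE /FracField.mulf.
rewrite !numden_Ratio ?mulf_neq0 ?denom_ratioP ?oner_neq0 //.
by rewrite !mulr1 mulrC.
Qed.

(** The embedding of K(X) in F with X sent to [x]. Transcendence makes the quotient independent of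
    the chosen representative; the boolean form of [fraction_ex] is what allows [xchoose]. *)
HB.lock Definition fev (K F : fieldType) (emb : {rmorphism K -> F}) (x : F)
    (tr : transcendental emb x) (q : {fraction {poly K}}) : F :=
  let nd := xchoose (fraction_ex q) in pev emb x nd.1 / pev emb x nd.2.

Section FractionEvaluation.
Variables (K F : fieldType) (emb : {rmorphism K -> F}) (x : F).
Hypothesis tr : transcendental emb x.

Local Notation fevx := (fev tr).

Lemma fevP q n d : d != 0 -> q * tofrac d = tofrac n ->
  fevx q = pev emb x n / pev emb x d.
Proof.
move=> d0 hq; rewrite fev.unlock; have /andP[] := xchooseP (fraction_ex q).
case: (xchoose _) => n' d' /= d0' /eqP hq'.
apply/eqP; rewrite eqr_div ?pev_eq0 // -!rmorphM /=; apply/eqP; congr pev.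
apply/eqP; rewrite -tofrac_eq !rmorphM /= -hq -hq'; apply/eqP; ring.
Qed.

Lemma fev_tofrac p : fevx (tofrac p) = pev emb x p.
Proof.
by rewrite (@fevP _ p 1) ?oner_eq0 ?rmorph1 ?mulr1 ?divr1.
Qed.

Fact fev_is_zmod_morphism : zmod_morphism fevx.
Proof.
move=> a b; have [[n d] /= /andP[d0 /eqP hd]] := fraction_ex a.
have [[n' d'] /= /andP[d0' /eqP hd']] := fraction_ex b.
rewrite (fevP d0 hd) (fevP d0' hd').
rewrite (@fevP _ (n * d' - n' * d) (d * d')) ?mulf_neq0 //.
  rewrite rmorphB !rmorphM /=.
  by field; rewrite !pev_eq0 // d0 d0'.
rewrite rmorphB !rmorphM /= -hd -hd'; ring.
Qed.

Fact fev_is_monoid_morphism : monoid_morphism fevx.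
Proof.
split; first by rewrite -(rmorph1 (@FracField.tofrac _)) fev_tofrac rmorph1.
move=> a b; have [[n d] /= /andP[d0 /eqP hd]] := fraction_ex a.
have [[n' d'] /= /andP[d0' /eqP hd']] := fraction_ex b.
rewrite (fevP d0 hd) (fevP d0' hd').
rewrite (@fevP _ (n * n') (d * d')) ?mulf_neq0 //.
  by rewrite !rmorphM /=; field; rewrite !pev_eq0 // d0 d0'.
rewrite !rmorphM /= -hd -hd'; ring.
Qed.

HB.instance Definition _ := GRing.isZmodMorphism.Build _ _ fevx
  fev_is_zmod_morphism.
HB.instance Definition _ := GRing.isMonoidMorphism.Build _ _ fevx
  fev_is_monoid_morphism.

End FractionEvaluation.

(** * The subfield K(x) and changes of parameter *)

Section RationalFunctions.
Variables (K F : fieldType) (emb : {rmorphism K -> F}).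

(** A predicate on F, so that K(x), K(x - b) and K(1/x) can be compared inside F. *)
Definition ratfun (x z : F) :=
  exists p q, pev emb x q != 0 /\ z = pev emb x p / pev emb x q.

Lemma ratfun_pev x p : ratfun x (pev emb x p).
Proof. by exists p, 1; rewrite rmorph1 oner_eq0 divr1. Qed.

Lemma ratfun_emb x c : ratfun x (emb c).
Proof. by rewrite -(pevC emb x); apply: ratfun_pev. Qed.

Lemma ratfun_id x : ratfun x x.
Proof. by rewrite -{2}(pevX emb x); apply: ratfun_pev. Qed.

Lemma ratfunD x a b : ratfun x a -> ratfun x b -> ratfun x (a + b).
Proof.
move=> [p [q [q0 ->]]] [p' [q' [q0' ->]]]; exists (p * q' + p' * q), (q * q').
by rewrite rmorphD !rmorphM /= mulf_neq0 //; split=> //; field; rewrite q0 q0'.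
Qed.

Lemma ratfunM x a b : ratfun x a -> ratfun x b -> ratfun x (a * b).
Proof.
move=> [p [q [q0 ->]]] [p' [q' [q0' ->]]]; exists (p * p'), (q * q').
by rewrite !rmorphM /= mulf_neq0 //; split=> //; field; rewrite q0 q0'.
Qed.

Lemma ratfunV x a : ratfun x a -> ratfun x a^-1.
Proof.
move=> [p [q [q0 ->]]]; case: (eqVneq (pev emb x p) 0) => [->|p0].
  by rewrite mul0r invr0 -(rmorph0 emb); apply: ratfun_emb.
by exists q, p; rewrite invf_div.
Qed.

Lemma ratfunX x a n : ratfun x a -> ratfun x (a ^+ n).
Proof.
move=> h; elim: n => [|n IHn]; last by rewrite exprS; apply: ratfunM.
by rewrite expr0 -(rmorph1 emb); apply: ratfun_emb.
Qed.

Lemma ratfun_trans x t z : ratfun x t -> ratfun t z -> ratfun x z.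
Proof.
move=> xt [p [q [_ ->]]].
have hp p' : ratfun x (pev emb t p').
  elim/poly_ind: p' => [|p' c IHp].
    by rewrite rmorph0 -(rmorph0 emb); apply: ratfun_emb.
  rewrite rmorphD rmorphM /= pevX pevC; apply: ratfunD (ratfun_emb _ _).
  exact: ratfunM.
exact: ratfunM (ratfunV _).
Qed.

Lemma ratfun_fev x (tr : transcendental emb x) q : ratfun x (fev tr q).
Proof.
have [[n d] /= /andP[d0 /eqP hd]] := fraction_ex q.
by exists n, d; rewrite (fevP tr d0 hd) pev_eq0.
Qed.

Lemma ratfunP x (tr : transcendental emb x) z :
  ratfun x z -> exists q, z = fev tr q.
Proof.
move=> [p [q [q0 ->]]]; exists (tofrac p / tofrac q).
by rewrite fmorph_div /= !fev_tofrac.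
Qed.

Definition spanning m (x y : F) := forall z, exists h : 'I_m -> F,
  (forall k, ratfun x (h k)) /\ z = \sum_(k < m) h k * y ^+ k.

Definition independent m (x y : F) := forall h : 'I_m -> F,
  (forall k, ratfun x (h k)) -> \sum_(k < m) h k * y ^+ k = 0 ->
  forall k, h k = 0.

(** The k-th generator is rescaled by a nonzero element of K(t). The factor t^c serves the point at
    infinity. *)
Lemma spanning_change m x y t c : t != 0 ->
  (forall z, ratfun x z -> ratfun t z) ->
  spanning m x y -> spanning m t (t ^+ c * y).
Proof.
move=> t0 xt span z; have [h [hx ->]] := span z.
exists (fun k => h k / (t ^+ c) ^+ k); split.
  move=> k; apply: ratfunM; first exact: xt.
  by apply: ratfunV; do 2!apply: ratfunX; apply: ratfun_id.
apply: eq_bigr => k _; rewrite exprMn mulrA divfK //.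
by rewrite expf_neq0 // expf_neq0.
Qed.

Lemma independent_change m x y t c : t != 0 -> ratfun x t ->
  independent m x y -> independent m t (t ^+ c * y).
Proof.
move=> t0 xt ind h ht h0 k; apply/eqP.
have nz : (t ^+ c) ^+ k != 0 by rewrite expf_neq0 // expf_neq0.
rewrite -(mulIr_eq0 _ (mulIf nz)); apply/eqP.
apply: (ind (fun k : 'I_m => h k * (t ^+ c) ^+ k)) => [j|].
  apply: ratfunM; first exact: ratfun_trans (ht j).
  by do 2!apply: ratfunX.
by rewrite -[RHS]h0; apply: eq_bigr => j _; rewrite exprMn mulrA.
Qed.

Lemma spanning_pev2 m x y : spanning m x y -> forall z, exists d P,
  pev emb x d != 0 /\ z * pev emb x d = pev2 emb x y P.
Proof.
move=> span z; have [h [hx ->]] := span z.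
have [n /fin_all_exists[d hd]] := fin_all_exists hx.
exists (\prod_k d k), (\sum_k (n k * \prod_(j | j != k) d j)%:P * 'X^k).
split; first by rewrite rmorph_prod; apply/prodf_neq0 => k _; case: (hd k).
rewrite mulr_suml rmorph_sum; apply: eq_bigr => k _.
rewrite rmorphM rmorphXn /= pev2X pev2C mulrAC; congr (_ * _).
rewrite (bigD1 k) //= !rmorphM /= mulrA; congr (_ * _).
by case: (hd k) => nz ->; rewrite divfK.
Qed.

Lemma independent_pev2 m x y : transcendental emb x -> independent m x y ->
  forall P : {poly {poly K}}, (size P <= m)%N -> pev2 emb x y P = 0 -> P = 0.
Proof.
move=> tr ind P sP; rewrite pev2E (@horner_coef_wide _ m); last first.
  exact: leq_trans (size_poly _ _) sP.
move=> P0; apply/polyP => k; rewrite coef0.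
have [mk|km] := leqP m k; first by rewrite nth_default // (leq_trans sP).
apply: tr; have := ind (fun k : 'I_m => pev emb x P`_k) _ _ (Ordinal km).
apply; first by move=> j; apply: ratfun_pev.
by rewrite -[RHS]P0; apply: eq_bigr => j _; rewrite coef_map.
Qed.

Lemma transcendental_sub x c :
  transcendental emb x -> transcendental emb (x - emb c).
Proof.
move=> tr p; rewrite -pevXsubC -pev_comp => /tr /eqP.
by rewrite comp_poly_eq0 ?size_XsubC // => /eqP.
Qed.

Lemma transcendental_inv x : transcendental emb x -> transcendental emb x^-1.
Proof.
move=> tr p hp; have x0 : x != 0.
  by have := transcendental_subC_neq0 0 tr; rewrite rmorph0 subr0.
(* The reversed polynomial x^(size p) p(1/x). It is taken one degree above that of [p], so its
   constant coefficient is 0. *)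
have q0 : \poly_(j < (size p).+1) p`_(size p - j) = 0.
  apply: tr; rewrite poly_def rmorph_sum /=.
  transitivity (x ^+ size p * pev emb x^-1 p); last by rewrite hp mulr0.
  rewrite pevE (@horner_coef_wide _ (size p).+1); last first.
    by rewrite (leq_trans (size_poly _ _)).
  rewrite mulr_sumr (reindex_inj rev_ord_inj) /=; apply: eq_bigr => j _.
  have jp : (j <= size p)%N by rewrite -ltnS.
  rewrite pevZ rmorphXn /= pevX subSS subKn // coef_map /= mulrCA; congr (_ * _).
  by rewrite exprVn -[X in _ = x ^+ X / _](subnK jp) exprD mulfK // expf_neq0.
apply/polyP => i; rewrite coef0; have [pi|ip] := leqP (size p) i.
  by rewrite nth_default.
have := congr1 (fun q : {poly K} => q`_(size p - i)) q0.
by rewrite coef0 coef_poly ltnS leq_subr subKn // ltnW.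
Qed.

End RationalFunctions.

(** * Irreducibility of the Kummer equation and the Galois action *)

Section Kummer.
Variables (K : closedFieldType) (F : fieldType) (emb : {rmorphism K -> F}).
Variables (m : nat) (f : {poly K}) (x y : F).
Hypotheses (mK : m%:R != 0 :> K) (f0 : f != 0).
Hypothesis tr : transcendental emb x.
Hypothesis ym : y ^+ m = pev emb x f.
Hypothesis notpow : forall d, (1 < d)%N -> (d %| m)%N ->
  ~ exists g : {fraction {poly K}}, g ^+ d = tofrac f.

Local Notation phi := (fev tr).

Let m0 : (0 < m)%N. Proof. by case: m mK => //; rewrite eqxx. Qed.

Let y0 : y != 0.
Proof.
have : y ^+ m != 0 by rewrite ym pev_eq0.
by rewrite expf_eq0 m0.
Qed.

Lemma primitive_root_ex : exists z : K, m.-primitive_root z.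
Proof.
have [r hr] := closed_field_poly_normal ('X^m - 1 : {poly K}).
have mp : 'X^m - 1 \is @monic K by rewrite monicXnsubC.
rewrite (monicP mp) scale1r in hr.
have ur : uniq r by rewrite -separable_prod_XsubC -hr separable_Xn_sub_1.
have sr : size r = m.
  by apply/eqP; rewrite -eqSS -(size_prod_XsubC r id) -hr size_XnsubC.
have ar : all m.-unity_root r.
  by apply/allP => z zr; rewrite /root_of_unity hr root_prod_XsubC.
have /hasP[z _ hz] := cyclic.has_prim_root m0 ar ur (eq_leq (esym sr)).
by exists z.
Qed.

Let A : {poly {fraction {poly K}}} := 'X^m - (tofrac f)%:P.

Lemma map_kummer : map_poly phi A = 'X^m - (y ^+ m)%:P.
Proof. by rewrite rmorphB /= map_polyXn map_polyC /= fev_tofrac ym. Qed.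

Lemma kummer_split z : m.-primitive_root z ->
  map_poly phi A =
  \prod_(a <- [seq z ^+ i | i <- iota 0 m]) ('X - (emb a * y)%:P).
Proof.
move=> pz; rewrite map_kummer; set s := map _ _.
have us : uniq [seq emb a * y | a <- s].
  rewrite map_inj_uniq; last by move=> a b /(mulIf y0) /fmorph_inj.
  rewrite map_inj_in_uniq ?iota_uniq // => i j; rewrite !mem_iota /= => hi hj.
  by move/eqP; rewrite (eq_prim_root_expr pz) !modn_small // => /eqP.
have mp : 'X^m - (y ^+ m)%:P \is monic by rewrite monicXnsubC.
rewrite [LHS](@all_roots_prod_XsubC _ _ [seq emb a * y | a <- s]).
- by rewrite (monicP mp) scale1r big_map.
- by rewrite size_map size_map size_iota size_XnsubC.
- apply/allP => _ /mapP[_ /mapP[i _ ->] ->].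
  rewrite /root hornerD hornerN hornerXn hornerC exprMn -rmorphXn -exprM.
  by rewrite mulnC exprM (prim_expr_order pz) expr1n rmorph1 mul1r subrr.
- by rewrite uniq_rootsE.
Qed.

Let solve_for (a b c e u : F) : c != 0 -> b != 0 -> e != 0 ->
  a * c = b * c * (e * u) -> u = a / b / e.
Proof.
move=> c0 b0 e0; rewrite mulrAC => /(mulIf c0) ->.
by rewrite [b * _]mulrC mulfK // mulrC mulKf.
Qed.

(** Over F a divisor q of degree n > 0 is, up to a scalar, a product of factors X - zeta^i y, so its
    constant coefficient puts y^n in K(x). With k = gcd(n, m), Bezout puts y^k in K(x) as well, and
    f is the (m/k)-th power of y^k. By hypothesis m = k, whence n = m. *)
Lemma kummer_irreducible : irreducible_poly A.
Proof.
have sA : size A = m.+1 by rewrite size_XnsubC.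
split=> [|q sq qA]; first by rewrite sA.
have [z pz] := primitive_root_ex.
have := qA; rewrite -(dvdp_map phi) (kummer_split pz); set s := map _ _.
case/dvdp_prod_XsubC => mm; set s' := mask mm s => hq.
have size_q : size q = (size s').+1.
  by rewrite -(size_map_poly phi) (eqp_size hq) size_prod_XsubC.
have [h hy] : exists h, y ^+ size s' = phi h.
  have [[c1 c2] /= /andP[c10 c20] hc] := eqpP _ _ hq.
  have lq : phi (lead_coef q) * c1 = c2.
    have := congr1 lead_coef hc; rewrite !lead_coefZ lead_coef_map.
    by rewrite (monicP (monic_prod_XsubC _ _ _)) mulr1 mulrC.
  have e0 : phi q.[0] * c1 = c2 * (emb (\prod_(a <- s') (- a)) * y ^+ size s').
    have := congr1 (fun p : {poly F} => p.[0]) hc; rewrite !hornerZ.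
    rewrite -[0 in LHS](rmorph0 phi) horner_map mulrC => ->; congr (_ * _).
    rewrite horner_prod rmorph_prod /=; elim: s' {hq size_q hc} => [|a r IHr].
      by rewrite !big_nil mulr1.
    rewrite !big_cons IHr hornerXsubC rmorphN exprS sub0r; ring.
  have k0 : emb (\prod_(a <- s') (- a)) != 0.
    rewrite fmorph_eq0 prodf_seq_neq0; apply/allP => a /mem_mask /mapP[i _ ->].
    rewrite /= oppr_eq0 expf_eq0; apply/negP => /andP[_ /eqP z0].
    have := prim_expr_order pz; rewrite z0 expr0n eqn0Ngt m0 => /eqP.
    by rewrite eq_sym oner_eq0.
  have lq0 : phi (lead_coef q) != 0.
    by apply: contraNneq c20 => h; rewrite -lq h mul0r.
  exists (q.[0] / lead_coef q / tofrac (\prod_(a <- s') (- a))%:P).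
  rewrite !fmorph_div /= fev_tofrac pevC.
  by subst c2; apply: solve_for c10 lq0 k0 e0.
have s0 : (0 < size s')%N by move: sq; rewrite size_q eqSS lt0n.
have sm : (size s' <= m)%N.
  by rewrite -ltnS -size_q -sA dvdp_leq // -size_poly_gt0 sA.
pose k := gcdn (size s') m.
have k_gt0 : (0 < k)%N by rewrite gcdn_gt0 s0.
have [h' hk] : exists h', y ^+ k = phi h'.
  case: (egcdnP m s0) => a b hab _; exists (h ^+ a / tofrac f ^+ b).
  rewrite fmorph_div !rmorphXn /= fev_tofrac -ym -hy -!exprM.
  by rewrite mulnC hab (mulnC m) exprD mulrC mulKf // expf_neq0.
have kdvd : (k %| m)%N by rewrite dvdn_gcdr.
have [lt|] := ltnP 1 (m %/ k)%N.
  case: (notpow lt (dvdn_div kdvd)); exists h'.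
  apply: (fmorph_inj phi); rewrite rmorphXn /= -hk -exprM mulnC divnK //.
  by rewrite ym fev_tofrac.
move=> le1; have mk : m = k.
  have q1 : (m %/ k)%N = 1%N.
    by apply/eqP; rewrite eqn_leq le1 divn_gt0 // dvdn_leq.
  by rewrite -{1}(divnK kdvd) q1 mul1n.
have ms : (m <= size s')%N by rewrite mk dvdn_leq // dvdn_gcdl.
rewrite -dvdp_size_eqp // size_q sA eqSS eqn_leq sm //.
Qed.

Lemma kummer_root : (map_poly phi A).[y] = 0.
Proof. by rewrite map_kummer hornerD hornerN hornerXn hornerC subrr. Qed.

Lemma kummer_dvd P : (map_poly phi P).[y] = 0 -> A %| P.
Proof.
move=> P0; apply: contraT.
rewrite -(irreducible_poly_coprime _ kummer_irreducible).
move/Bezout_eq1_coprimepP => [[u v] /= /(congr1 (map_poly phi)) uv].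
have := congr1 (fun p : {poly F} => p.[y]) uv.
rewrite /= rmorphD !rmorphM /= rmorph1 hornerD !hornerM P0 kummer_root hornerC.
by rewrite !mulr0 addr0 => /esym/eqP; rewrite oner_eq0.
Qed.

Hypothesis gen : forall z : F, exists p q : {poly {poly K}},
  evalxy emb x y q != 0 /\ z = evalxy emb x y p / evalxy emb x y q.

(** A denominator nonzero at [y] is coprime to the irreducible [A], so Bezout inverts it and F =
    K(x)[y]. The boolean equality lets [xchoose] pick a representative later. *)
Lemma kummer_gen z : exists P : {poly {fraction {poly K}}},
  (map_poly phi P).[y] == z.
Proof.
have ev P : pev2 emb x y P = (map_poly phi (map_poly tofrac P)).[y].
  rewrite pev2E -map_poly_comp; congr horner; apply: eq_map_poly => p /=.
  by rewrite fev_tofrac.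
have [p [q [q0 ->]]] := gen z; rewrite !evalxyE !ev in q0 *.
set Q := map_poly tofrac q in q0 *; set P := map_poly tofrac p.
have : coprimep A Q.
  rewrite (irreducible_poly_coprime _ kummer_irreducible).
  apply: contraNN q0 => /dvdpP[R ->].
  by rewrite rmorphM hornerM kummer_root mulr0.
move/Bezout_eq1_coprimepP => [[u v] /= /(congr1 (map_poly phi)) uv].
have := congr1 (fun p : {poly F} => p.[y]) uv.
rewrite /= rmorphD !rmorphM /= rmorph1 hornerD !hornerM kummer_root hornerC.
rewrite mulr0 add0r => vq; exists (P * v); apply/eqP.
by rewrite rmorphM hornerM; congr (_ * _); rewrite -[RHS]mul1r -vq mulfK.
Qed.

Theorem kummer_spanning : spanning emb m x y.
Proof.
move=> z; have [P /eqP <-] := kummer_gen z.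
exists (fun k => phi (P %% A)`_k); split; first by move=> k; apply: ratfun_fev.
have -> : (map_poly phi P).[y] = (map_poly phi (P %% A)).[y].
  rewrite {1}(divp_eq P A) rmorphD rmorphM hornerD hornerM kummer_root mulr0.
  by rewrite add0r.
rewrite (@horner_coef_wide _ m); last first.
  rewrite size_map_poly -ltnS -(size_XnsubC (tofrac f) m0) ltn_modp.
  by rewrite -size_poly_gt0 size_XnsubC.
by apply: eq_bigr => k _; rewrite coef_map.
Qed.

Theorem kummer_independent : independent emb m x y.
Proof.
move=> h hx h0 k.
have [q hq] : exists q : 'I_m -> {fraction {poly K}}, forall k, h k = phi (q k).
  by apply: (fin_all_exists (P := fun k q => h k = phi q)) => j; apply: ratfunP.
pose P := \sum_(j < m) (q j)%:P * 'X^j.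
have : A %| P.
  apply: kummer_dvd; rewrite -[RHS]h0 rmorph_sum horner_sum.
  apply: eq_bigr => j _; rewrite rmorphM /= map_polyC map_polyXn.
  by rewrite hornerM hornerC hornerXn hq.
have PE : P = \poly_(j < m) (if insub j is Some i then q i else 0).
  rewrite poly_def; apply: eq_bigr => j _; rewrite mul_polyC; congr (_ *: _).
  by rewrite valK.
have P0 : A %| P -> P = 0.
  move=> AP; apply: contraTeq AP => nz; apply/negP => /(dvdp_leq nz).
  by rewrite size_XnsubC // leqNgt ltnS PE size_poly.
move/P0 => {}P0; have := congr1 (fun p : {poly _} => p`_k) P0.
by rewrite PE coef_poly ltn_ord valK coef0 hq => ->; rewrite rmorph0.
Qed.

(** [sigma] substitutes c y for y in a chosen representative. Two representatives differ by a
    multiple of [A], and c y is again a root of [A], so the choice does not matter. *)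
Theorem kummer_galois (c : K) : c ^+ m = 1 -> exists sigma : F -> F,
  [/\ {morph sigma : a b / a + b}, {morph sigma : a b / a * b},
      forall h, ratfun emb x h -> sigma h = h & sigma y = emb c * y].
Proof.
move=> cm; pose sigma z := (map_poly phi (xchoose (kummer_gen z))).[emb c * y].
have sE P : sigma (map_poly phi P).[y] = (map_poly phi P).[emb c * y].
  rewrite /sigma; have /eqP := xchooseP (kummer_gen (map_poly phi P).[y]).
  set Q := xchoose _ => QP; apply/eqP; rewrite -subr_eq0 -hornerN -hornerD -rmorphB.
  have /dvdpP[R ->] : A %| Q - P.
    by apply: kummer_dvd; rewrite rmorphB hornerD hornerN QP subrr.
  rewrite rmorphM /= hornerM map_kummer hornerD hornerN hornerXn hornerC exprMn.
  by rewrite -rmorphXn cm rmorph1 mul1r subrr mulr0.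
exists sigma; split=> [a b|a b|h hx|].
- have [P /eqP <-] := kummer_gen a; have [Q /eqP <-] := kummer_gen b.
  by rewrite -hornerD -rmorphD !sE rmorphD hornerD.
- have [P /eqP <-] := kummer_gen a; have [Q /eqP <-] := kummer_gen b.
  by rewrite -hornerM -rmorphM !sE rmorphM hornerM.
- have [q ->] := ratfunP tr hx.
  by have := sE q%:P; rewrite map_polyC !hornerC.
- by have := sE 'X; rewrite map_polyX !hornerX.
Qed.

End Kummer.

(** * Monomials in Riemann-Roch spaces *)

(** Here [a] is the value of the local parameter, [V] that of the monomial, L = k lambda_i, and [b]
    says that the place lies over P_u. There g a = m turns the term c g of the floor into the pole
    order c. *)
Lemma floor_value_ge (m c g : nat) (b : bool) (a V L : int) : (0 < m)%N ->
    0 < a -> (b -> g%:Z * a = m%:Z) ->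
    a * (L - m%:Z * (((if b then c * g else 0)%N%:Z + L) %/ m%:Z)%Z) <= m%:Z * V ->
  - (if b then c%:Z else 0) <= V.
Proof.
move=> m0 a0 gb; set n := divz _ _ => h.
have : n * m%:Z <= (if b then c * g else 0)%N%:Z + L by apply: lez_floor; lia.
move: n h => n h hn; case: b gb hn => [/(_ isT) gb|_] /= hn; last by nia.
have : - (c%:Z * m%:Z) <= m%:Z * V by rewrite -gb; nia.
by nia.
Qed.

(** Sharpness of the floor: one order less in h already violates the bound at a place over the
    point. *)
Lemma floor_value_lt (m c g : nat) (b : bool) (a V L : int) : (0 < m)%N ->
    0 < a -> (b -> g%:Z * a = m%:Z) ->
    m%:Z * V <=
      a * (L - m%:Z * ((((if b then c * g else 0)%N%:Z + L) %/ m%:Z)%Z + 1)) ->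
  V < - (if b then c%:Z else 0).
Proof.
move=> m0 a0 gb; set n := divz _ _ => h.
have : (if b then c * g else 0)%N%:Z + L < (n + 1) * m%:Z by apply: ltz_ceil.
move: n h => n h hn; case: b gb hn => [/(_ isT) gb|_] /= hn; last by nia.
have : m%:Z * V < - (c%:Z * m%:Z) by rewrite -gb; nia.
by nia.
Qed.

Lemma value_at (m k : nat) (a n l vp vy : int) : m%:Z * vy = a * l ->
  m%:Z * (a * - n + vp + vy *+ k) = a * (k%:Z * l - m%:Z * n) + m%:Z * vp.
Proof.
move=> h; rewrite -(mulr_natr vy) natz.
have -> : m%:Z * (a * - n + vp + vy * k%:Z) =
  a * - n * m%:Z + m%:Z * vp + m%:Z * vy * k%:Z by ring.
by rewrite h; ring.
Qed.

Lemma value_lt_at (m : nat) (a L n w : int) : 0 < a -> w <= - a ->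
  a * (L - m%:Z * n) + m%:Z * w <= a * (L - m%:Z * (n + 1)).
Proof. by move=> a0 wa; nia. Qed.

Lemma value_pole (m k d : nat) (b n l vy : int) : m%:Z * vy = - b * l ->
  m%:Z * (b * - n + b *+ d + vy *+ k) = - b * (k%:Z * l - m%:Z * (d%:Z - n)).
Proof.
move=> h; rewrite -(mulr_natr vy) -(mulr_natr b) !natz.
have -> : m%:Z * (b * - n + b * d%:Z + vy * k%:Z) =
  b * (d%:Z - n) * m%:Z + m%:Z * vy * k%:Z by ring.
by rewrite h; ring.
Qed.

(* The monomial [h y^k] lies in [L(c D_u)] iff the divisor of [h] is at least
   [- sum_i nfloor i] on the projective line. *)
Definition nfloor (m r : nat) (lam : nat -> nat) (u c k i : nat) : int :=
  (((if i == u then c * gcdn m `|lamE r lam u| else 0)%N%:Z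
    + k%:Z * lamE r lam i) %/ m%:Z)%Z.

Definition floor_deg m r lam u c k : int :=
  \sum_(0 <= i < r.+2) nfloor m r lam u c k i.

Definition floor_dim m r lam u c k : nat :=
  if 0 <= floor_deg m r lam u c k then `|floor_deg m r lam u c k|.+1 else 0%N.

Lemma floor_dimP m r lam u c k d :
  (d < floor_dim m r lam u c k)%N = (d%:Z <= floor_deg m r lam u c k).
Proof. by rewrite /floor_dim; case: ifP; lia. Qed.

Lemma sum_lamE r lam : \sum_(0 <= i < r.+1) lamE r lam i = - lamE r lam r.+1.
Proof.
rewrite big_ltn // add0r /lamE ltnn opprK /= (big_morph Posz PoszD (erefl 0)).
apply: eq_big_nat => i /andP[i1 ir].
by rewrite gtn_eqF //= -ltnS ir.
Qed.

(** * Places of the Kummer extension *)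

Section KummerPlaces.
Variables (K : closedFieldType) (F : fieldType) (emb : {rmorphism K -> F}).
Variables (m r : nat) (alpha : nat -> K) (lam : nat -> nat) (x y : F).
Hypothesis mK : m%:R != 0 :> K.
Hypothesis alpha_inj : forall a b, (a <= r)%N -> (b <= r)%N ->
  a <> b -> alpha a <> alpha b.
Hypothesis notpow : forall d, (1 < d)%N -> (d %| m)%N ->
  ~ exists g : {fraction {poly K}},
      g ^+ d = FracField.tofrac (kummer_poly r alpha lam).
Hypothesis tr : transcendental emb x.
Hypothesis ym :
  y ^+ m = \prod_(1 <= i < r.+1) (x - emb (alpha i)) ^+ lam i.
Hypothesis gen : forall z : F, exists p q : {poly {poly K}},
  evalxy emb x y q != 0 /\ z = evalxy emb x y p / evalxy emb x y q.

Local Notation lm := (lamE r lam).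
Let f := kummer_poly r alpha lam.

Let m0 : (0 < m)%N. Proof. by case: m mK => //; rewrite eqxx. Qed.

Let x0 : x != 0.
Proof. by have := transcendental_subC_neq0 0 tr; rewrite rmorph0 subr0. Qed.

Let xa0 c : x - emb c != 0. Proof. exact: transcendental_subC_neq0. Qed.

Let pev_f : pev emb x f = y ^+ m.
Proof.
rewrite ym rmorph_prod; apply: eq_bigr => i _.
by rewrite rmorphXn /= pevXsubC.
Qed.

Let f_neq0 : f != 0.
Proof.
rewrite /f /kummer_poly prodf_seq_neq0; apply/allP => i _ /=.
by rewrite expf_neq0 // polyXsubC_eq0.
Qed.

Let y0 : y != 0.
Proof.
have : y ^+ m != 0 by rewrite -pev_f pev_eq0.
by rewrite expf_eq0 m0.
Qed.

Let ymE : y ^+ m = \prod_(0 <= i < r.+1) (x - emb (alpha i)) ^ lm i.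
Proof.
rewrite big_ltn // expr0z mul1r ym; apply: eq_big_nat => i /andP[i1 ir].
by rewrite /lamE gtn_eqF //= -ltnS ir exprnP.
Qed.

Lemma kummer_span : spanning emb m x y.
Proof. exact: kummer_spanning mK f_neq0 tr (esym pev_f) notpow gen. Qed.

Lemma kummer_indep : independent emb m x y.
Proof. exact: kummer_independent mK f_neq0 tr (esym pev_f) notpow. Qed.

Lemma kummer_local_finite (b : K) :
  let t := x - emb b in
  [/\ t != 0, transcendental emb t, spanning emb m t y & independent emb m t y].
Proof.
move=> t; have t0 : t != 0 by apply: xa0.
have xt : ratfun emb x t.
  by rewrite /t -rmorphN; apply: ratfunD (ratfun_emb _ _ _); apply: ratfun_id.
have tx : ratfun emb t x.
  rewrite -[X in ratfun _ _ X](subrK (emb b)).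
  by apply: ratfunD (ratfun_emb _ _ _); apply: ratfun_id.
split=> //; first exact: transcendental_sub.
  have := spanning_change 0 t0 (fun z => ratfun_trans tx) kummer_span.
  by rewrite expr0 mul1r.
by have := independent_change (c := 0%N) t0 xt kummer_indep; rewrite expr0 mul1r.
Qed.

Lemma kummer_local_infty (c : nat) :
  let t := x^-1 in
  [/\ t != 0, transcendental emb t, spanning emb m t (t ^+ c * y)
    & independent emb m t (t ^+ c * y)].
Proof.
move=> t; have t0 : t != 0 by rewrite invr_eq0.
have xt : ratfun emb x t by apply: ratfunV; apply: ratfun_id.
have tx : ratfun emb t x by rewrite -[x]invrK; apply: ratfunV; apply: ratfun_id.
split=> //; first exact: transcendental_inv.
  exact: spanning_change _ t0 (fun z => ratfun_trans tx) kummer_span.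
exact: independent_change t0 xt kummer_indep.
Qed.

(* [y] is multiplied by a power of [1/x] so that the exponent [l] of the local
   equation [y^m = t^l U(t)] at infinity is a natural number. *)
Lemma kummer_eq_infty (c := (\sum_(1 <= i < r.+1) lam i)%N) :
  let t := x^-1 in
  let U := \prod_(1 <= i < r.+1) (1 - (alpha i) *: 'X) ^+ lam i in
  U.[0] != 0 /\ (t ^+ c * y) ^+ m = t ^+ (c * m.-1) * pev emb t U.
Proof.
move=> t U; split.
  rewrite horner_prod prodf_seq_neq0; apply/allP => i _ /=.
  by rewrite horner_exp !hornerE ?mulr0 ?subr0 expr1n oner_eq0.
have -> : (t ^+ c * y) ^+ m = t ^+ (c * m.-1) * (t ^+ c * y ^+ m).
  by rewrite exprMn -exprM mulrA -exprD -mulnSr prednK.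
congr (_ * _); rewrite ym -prodrXr -big_split rmorph_prod /=.
apply: eq_bigr => i _; rewrite -exprMn rmorphXn rmorphB rmorph1 /= pevZ pevX.
by rewrite mulrBr mulVf // [emb _ * t]mulrC.
Qed.

Lemma kummer_eq_finite (b : K) l (q : {poly K}) : f = q * ('X - b%:P) ^+ l ->
  y ^+ m = (x - emb b) ^+ l * pev emb (x - emb b) (q \Po ('X + b%:P)).
Proof.
move=> fE; rewrite -pev_f fE rmorphM rmorphXn /= pevXsubC mulrC; congr (_ * _).
by rewrite pev_comp rmorphD /= pevX pevC subrK.
Qed.

(** Stated for every b in K, with l the multiplicity of b in f, possibly 0: a pole of a coefficient
    h at any point must be detected by some place. *)
Lemma place_finite_ex (b : K) : exists v, is_place emb v /\ 0 < v (x - emb b).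
Proof.
have [l [q q0 fE]] := multiplicity_XsubC f b.
have [t0 tt span ind] := kummer_local_finite b.
rewrite f_neq0 /= /root in q0.
have U0 : (q \Po ('X + b%:P)).[0] != 0 by rewrite horner_comp !hornerE.
exact: (exists_place mK U0 tt (kummer_eq_finite fE) (spanning_pev2 span)
  (independent_pev2 tt ind)).
Qed.

Lemma place_infty_ex : exists v, is_place emb v /\ v x < 0.
Proof.
have [t0 tt span ind] := kummer_local_infty (\sum_(1 <= i < r.+1) lam i)%N.
have [U0 ymt] := kummer_eq_infty.
have [v [vp]] : exists v, is_place emb v /\ 0 < v x^-1.
  exact: (exists_place mK U0 tt ymt (spanning_pev2 span)
    (independent_pev2 tt ind)).
by rewrite (placeV vp) // oppr_gt0; exists v.
Qed.

Section OnePlace.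
Variables (v : F -> int) (vp : is_place emb v).

Lemma place_alpha_unique i j : (i <= r)%N -> (j <= r)%N ->
  0 < v (x - emb (alpha i)) -> j != i -> v (x - emb (alpha j)) = 0.
Proof.
move=> ir jr vi ji; have hi : vge v 1 (x - emb (alpha i)) by apply/orP; right; lia.
have := place_pev_unit vp (p := 'X - (alpha j)%:P) hi.
rewrite pevXsubC hornerXsubC subr_eq0; case=> //.
by apply/eqP => /alpha_inj; apply => //; apply/eqP; rewrite eq_sym.
Qed.

Lemma place_prod_alpha (e : nat -> int) :
  v (\prod_(0 <= i < r.+1) (x - emb (alpha i)) ^ e i) =
  \sum_(0 <= i < r.+1) v (x - emb (alpha i)) * e i.
Proof.
rewrite (place_prod vp); last by move=> i; rewrite expfz_neq0.
by apply: eq_bigr => i _; rewrite (placeXz vp).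
Qed.

Lemma place_prod_at (e : nat -> int) i : (i <= r)%N ->
    0 < v (x - emb (alpha i)) ->
  v (\prod_(0 <= i < r.+1) (x - emb (alpha i)) ^ e i) =
  v (x - emb (alpha i)) * e i.
Proof.
move=> ir vi; rewrite place_prod_alpha (bigD1_seq i) ?iota_uniq //=; last first.
  by rewrite mem_index_iota.
rewrite big_seq_cond big1 ?addr0 // => j; rewrite mem_index_iota ltnS /=.
by move=> /andP[jr ji]; rewrite (place_alpha_unique ir jr vi ji) mul0r.
Qed.

Lemma place_pole_sub c : v x < 0 -> v (x - emb c) = v x.
Proof.
move=> vx; have := place_pev_pole vp x0 vx (p := 'X - c%:P).
by rewrite polyXsubC_eq0 pevXsubC size_XsubC => /(_ isT)[].
Qed.

Lemma place_prod_pole (e : nat -> int) : v x < 0 ->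
  v (\prod_(0 <= i < r.+1) (x - emb (alpha i)) ^ e i) =
  v x * \sum_(0 <= i < r.+1) e i.
Proof.
move=> vx; rewrite place_prod_alpha mulr_sumr; apply: eq_bigr => i _.
by rewrite place_pole_sub.
Qed.

Lemma place_y_at i : (i <= r)%N -> 0 < v (x - emb (alpha i)) ->
  m%:Z * v y = v (x - emb (alpha i)) * lm i.
Proof.
move=> ir vi; rewrite -(place_prod_at _ ir vi) -ymE (placeX vp) //.
by rewrite -mulr_natr natz mulrC.
Qed.

Lemma place_y_pole : v x < 0 -> m%:Z * v y = - v x * lm r.+1.
Proof.
move=> vx; rewrite mulNr -mulrN -sum_lamE -place_prod_pole // -ymE (placeX vp) //.
by rewrite -mulr_natr natz mulrC.
Qed.

Lemma ramification_finite i : (i <= r)%N -> 0 < v (x - emb (alpha i)) ->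
  (gcdn m `|lm i|)%:Z * v (x - emb (alpha i)) = m%:Z.
Proof.
move=> ir vi; have [t0 tt span _] := kummer_local_finite (alpha i).
pose q := \prod_(1 <= j < r.+1 | j != i) ('X - (alpha j)%:P) ^+ lam j.
have fE : f = q * ('X - (alpha i)%:P) ^+ `|lm i|.
  rewrite /f /kummer_poly /q; have [->|i0] := posnP i.
    rewrite mulr1; apply: congr_big_nat => // j /andP[j1 _].
    by rewrite gtn_eqF.
  rewrite (bigD1_seq i) ?iota_uniq ?mem_index_iota ?i0 //= mulrC.
  by rewrite /lamE gtn_eqF //= ir.
have q0 : (q \Po ('X + (alpha i)%:P)).[0] != 0.
  rewrite horner_comp !hornerE horner_prod prodf_seq_neq0.
  apply/allP => j; rewrite mem_index_iota ltnS => /andP[_ jr].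
  apply/implyP => ji; rewrite horner_exp hornerXsubC expf_neq0 // subr_eq0.
  by apply/eqP => /alpha_inj; apply => //; apply/eqP; rewrite eq_sym.
exact: (ramification_index vp vi t0 mK q0 (kummer_eq_finite fE) (spanning_pev2 span)).
Qed.

Lemma ramification_pole : v x < 0 -> (gcdn m `|lm r.+1|)%:Z * - v x = m%:Z.
Proof.
move=> vx; have [t0 tt span _] := kummer_local_infty (\sum_(1 <= i < r.+1) lam i)%N.
have [U0 ymt] := kummer_eq_infty.
have vt : 0 < v x^-1 by rewrite (placeV vp) // oppr_gt0.
have := ramification_index vp vt t0 mK U0 ymt (spanning_pev2 span).
rewrite (placeV vp) // /lamE ltnn /= abszN absz_nat => <-; congr (Posz _ * _).
(* The local exponent at infinity is c (m - 1), and m - 1 is prime to m, so its gcd with m is that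
   of c. *)
by rewrite Gauss_gcdl // -{1}(prednK m0) coprimeSn.
Qed.

End OnePlace.

(** * Membership of a monomial in L(c D_u) *)

Variables (u : nat) (c : nat).
Hypothesis hu : (u <= r.+1)%N.

Local Notation lies v := (lies_over emb x r alpha u v).
Local Notation inL := (in_LD emb x r alpha u c).
Local Notation nf := (nfloor m r lam u c).
Local Notation fdeg := (floor_deg m r lam u c).
Local Notation fdim := (floor_dim m r lam u c).

Lemma lies_over_at v i : is_place emb v -> (i <= r)%N ->
  0 < v (x - emb (alpha i)) -> lies v = (i == u).
Proof.
move=> vp ir vi; rewrite /lies_over; case: (leqP u r) => ur.
  case: (eqVneq i u) vi => [->//|iu] vi.
  by rewrite (place_alpha_unique vp ir ur vi) // eq_sym.
rewrite (_ : (i == u) = false); last first.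
  by apply/negbTE; rewrite neq_ltn (leq_ltn_trans ir ur).
apply/negbTE; rewrite -leNgt -(vgeP v 0 x0).
by apply: (vge_subC vp (c := alpha i)); rewrite (vgeP v 0 (xa0 _)) ltW.
Qed.

Lemma lies_over_pole v : is_place emb v -> v x < 0 -> lies v = (r.+1 == u).
Proof.
move=> vp vx; rewrite /lies_over; case: (leqP u r) => ur.
  rewrite gtn_eqF ?ltnS // (place_pole_sub vp) //.
  by rewrite lt_gtF.
by rewrite vx; apply/esym; rewrite eq_sym eqn_leq hu ur.
Qed.

Lemma inLP z : inL z <->
  forall v, is_place emb v -> vge v (- (if lies v then c%:Z else 0)) z.
Proof.
split=> [[->|h] v vp|h]; first exact: vge0.
  by rewrite /vge h // orbT.
case: (eqVneq z 0) => [->|z0]; [by left|right=> v vp].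
by rewrite -(vgeP v _ z0) h.
Qed.

Lemma inL0 : inL 0. Proof. by left. Qed.

Lemma inLD a b : inL a -> inL b -> inL (a + b).
Proof.
by move=> /inLP ha /inLP hb; apply/inLP => v vp; apply: (vgeD vp); auto.
Qed.

Lemma inLZ d a : inL a -> inL (emb d * a).
Proof.
move=> /inLP ha; apply/inLP => v vp; rewrite -[X in vge _ X]add0r.
by apply: (vgeM vp); [apply: (vge_emb vp)|apply: ha].
Qed.

(** The coefficient with the largest poles (least zeros) allowed at the finite points. Every
    admissible h is this one times a polynomial, whose degree is then bounded at infinity. *)
Definition mono_coef k : F :=
  \prod_(0 <= i < r.+1) (x - emb (alpha i)) ^ (- nf k i).

Lemma mono_coef_neq0 k : mono_coef k != 0.
Proof. by rewrite prodf_seq_neq0; apply/allP => i _ /=; rewrite expfz_neq0. Qed.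

Lemma ratfun_mono_coef k : ratfun emb x (mono_coef k).
Proof.
apply: (big_ind (ratfun emb x)) => [||i _].
- by rewrite -(rmorph1 emb); apply: ratfun_emb.
- by move=> *; apply: ratfunM.
have xi : ratfun emb x (x - emb (alpha i)).
  by rewrite -pevXsubC; apply: ratfun_pev.
case: (- nf k i) => n; first exact: ratfunX.
by apply: ratfunV; apply: ratfunX.
Qed.

Lemma place_mono v a k : is_place emb v -> a != 0 ->
  v (mono_coef k * a * y ^+ k) = v (mono_coef k) + v a + v y *+ k.
Proof.
move=> vp a0; have G0 := mono_coef_neq0 k.
by rewrite !(placeM vp) ?mulf_neq0 ?expf_neq0 // (placeX vp).
Qed.

Lemma place_mono_at v a k i : is_place emb v -> a != 0 -> (i <= r)%N ->
    0 < v (x - emb (alpha i)) ->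
  m%:Z * v (mono_coef k * a * y ^+ k) =
  v (x - emb (alpha i)) * (k%:Z * lm i - m%:Z * nf k i) + m%:Z * v a.
Proof.
move=> vp a0 ir vi; rewrite place_mono // (place_prod_at vp _ ir vi).
exact: value_at (place_y_at vp ir vi).
Qed.

Lemma place_mono_unit v a k : is_place emb v -> a != 0 ->
    (forall i, (i <= r)%N -> v (x - emb (alpha i)) = 0) ->
  v (mono_coef k * a * y ^+ k) = v a.
Proof.
move=> vp a0 va.
have vprod e : v (\prod_(0 <= i < r.+1) (x - emb (alpha i)) ^ e i) = 0.
  rewrite (place_prod_alpha vp) big_nat_cond big1 // => i.
  by rewrite andbT ltnS => /andP[_ ir]; rewrite va // mul0r.
have vy : v y = 0.
  have := congr1 v ymE; rewrite vprod (placeX vp) // => /eqP.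
  by rewrite mulrn_eq0 eqn0Ngt m0 => /eqP.
by rewrite place_mono // vprod vy mul0rn addr0 add0r.
Qed.

Lemma place_mono_pole v (p : {poly K}) k : is_place emb v -> p != 0 -> v x < 0 ->
  m%:Z * v (mono_coef k * pev emb x p * y ^+ k) =
  - v x * (k%:Z * lm r.+1 - m%:Z * ((size p).-1%:Z - \sum_(0 <= i < r.+1) nf k i)).
Proof.
move=> vp p0 vx; have [p1 vpx] := place_pev_pole vp x0 vx p0.
rewrite place_mono // (place_prod_pole vp _ vx) vpx sumrN.
exact: value_pole (place_y_pole vp vx).
Qed.

Lemma ram_at v i : is_place emb v -> (i <= r)%N -> 0 < v (x - emb (alpha i)) ->
  i == u -> (gcdn m `|lm u|)%:Z * v (x - emb (alpha i)) = m%:Z.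
Proof. by move=> vp ir vi /eqP <-; apply: ramification_finite. Qed.

Lemma ram_pole v : is_place emb v -> v x < 0 ->
  r.+1 == u -> (gcdn m `|lm u|)%:Z * - v x = m%:Z.
Proof. by move=> vp vx /eqP <-; apply: ramification_pole. Qed.

Lemma floor_degS k : fdeg k = \sum_(0 <= i < r.+1) nf k i + nf k r.+1.
Proof. by rewrite /floor_deg big_nat_recr. Qed.

Lemma mono_inL (p : {poly K}) k : (size p <= fdim k)%N ->
  inL (mono_coef k * pev emb x p * y ^+ k).
Proof.
move=> sp; case: (eqVneq p 0) => [->|p0].
  by rewrite rmorph0 mulr0 mul0r; left.
have a0 : pev emb x p != 0 by rewrite pev_eq0.
have {}sp : (size p).-1%:Z <= fdeg k.
  by rewrite -floor_dimP prednK // size_poly_gt0.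
(* Three kinds of places: poles of x, zeros of some x - alpha_i, and the others, where y and all x -
   alpha_i are units. *)
right=> v vp; have [vx|vx] := ltP (v x) 0.
  rewrite lies_over_pole //.
  apply: (floor_value_ge (L := k%:Z * lm r.+1) m0 _ (ram_pole vp vx)).
    by rewrite oppr_gt0.
  rewrite place_mono_pole // ler_pM2l ?oppr_gt0 // lerD2l lerN2 -/(nf k r.+1).
  rewrite ler_pM2l ?ltz_nat // lerBlDr addrC -floor_degS //.
have vx0 : vge v 0 x by rewrite (vgeP v 0 x0).
have vp0 : 0 <= v (pev emb x p) by rewrite -(vgeP v 0 a0); apply: (vge_pev vp).
have vxa c' : 0 <= v (x - emb c').
  by rewrite -(vgeP v 0 (xa0 c')); apply: (vgeB vp vx0 (vge_emb vp _)).
have [/hasP[i]|no] :=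
    boolP (has (fun i => 0 < v (x - emb (alpha i))) (iota 0 r.+1)).
  rewrite mem_iota ltnS /= => ir vi.
  rewrite (lies_over_at vp ir vi); 
  apply: (floor_value_ge (L := k%:Z * lm i) m0 vi (ram_at vp ir vi)).
  by rewrite (place_mono_at _ vp a0 ir vi) -/(nf k i) lerDl mulr_ge0.
have va i : (i <= r)%N -> v (x - emb (alpha i)) = 0.
  move=> ir; apply/eqP; rewrite eq_le vxa andbT leNgt.
  by apply: contra no => vi; apply/hasP; exists i; rewrite ?mem_iota.
rewrite (place_mono_unit _ vp a0 va); apply: le_trans vp0.
by case: ifP; rewrite ?oppr0 // oppr_le0.
Qed.

Lemma ratfun_coprime z : ratfun emb x z -> exists a b : {poly K},
  [/\ b != 0, coprimep a b & z = pev emb x a / pev emb x b].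
Proof.
move=> [a [b [b0 ->]]]; have nb : b != 0 by rewrite -(pev_eq0 _ tr).
have g0 : gcdp a b != 0 by rewrite gcdp_eq0 (negPf nb) andbF.
have aE := divpK (dvdp_gcdl a b); have bE := divpK (dvdp_gcdr a b).
exists (a %/ gcdp a b), (b %/ gcdp a b); split.
- by rewrite dvdp_div_eq0 ?dvdp_gcdr.
- by apply: coprimep_div_gcd; rewrite nb orbT.
- have -> : pev emb x a = pev emb x (a %/ gcdp a b) * pev emb x (gcdp a b).
    by rewrite -rmorphM /= aE.
  have -> : pev emb x b = pev emb x (b %/ gcdp a b) * pev emb x (gcdp a b).
    by rewrite -rmorphM /= bE.
  by rewrite -mulf_div mulfV ?mulr1 // pev_eq0.
Qed.

(** Dividing by [mono_coef k] leaves a reduced fraction a / b. A root of b would push the value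
    below the bound at a place above it, so b is constant; a place at infinity then bounds the
    degree of a. *)
Lemma inL_mono h k : ratfun emb x h -> inL (h * y ^+ k) ->
  exists p : {poly K}, (size p <= fdim k)%N /\ h = mono_coef k * pev emb x p.
Proof.
move=> hx; case: (eqVneq h 0) => [->|h0].
  by exists 0; rewrite size_poly0 rmorph0 mulr0.
case=> [/eqP|hL]; first by rewrite mulf_eq0 (negPf h0) (negPf (expf_neq0 _ y0)).
have G0 := mono_coef_neq0 k.
have [a [b [b0 cab hab]]] : exists a b : {poly K},
    [/\ b != 0, coprimep a b & h / mono_coef k = pev emb x a / pev emb x b].
  apply: ratfun_coprime; apply: ratfunM => //; apply: ratfunV.
  exact: ratfun_mono_coef.
have hE : h = mono_coef k * (pev emb x a / pev emb x b).
  by rewrite -hab mulrC divfK.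
have a0 : pev emb x a != 0.
  by apply: contraNneq h0 => a0; rewrite hE a0 mul0r mulr0.
have pb0 : pev emb x b != 0 by rewrite pev_eq0.
(* K is algebraically closed, so a nonconstant b has a root t. There a is a unit and b costs at
   least v(x - t), one full order more than the floor admits. *)
have sb : size b == 1%N.
  apply: contraT => /closed_rootP[t bt].
  have at0 : a.[t] != 0 by apply: coprimep_root bt; rewrite coprimep_sym.
  have [v [vp vt]] := place_finite_ex t.
  have vt1 : vge v 1 (x - emb t) by rewrite (vgeP v 1 (xa0 _)) -gtz0_ge1.
  have [_ va] := place_pev_unit vp vt1 at0.
  have vb : v (x - emb t) <= v (pev emb x b).
    have /factor_theorem[b' bE] := bt; move: pb0.
    rewrite bE rmorphM /= pevXsubC mulf_eq0 negb_or => /andP[nz _].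
    rewrite (placeM vp) // lerDr -(vgeP v 0 nz); apply: (vge_pev vp).
    by apply: (vge_subC vp (c := t)); apply: vgeW vt1.
  have vq : v (pev emb x a / pev emb x b) <= - v (x - emb t).
    by rewrite (placeM vp) ?invr_eq0 // (placeV vp) // va add0r lerN2.
  have q0 : pev emb x a / pev emb x b != 0 by rewrite mulf_neq0 ?invr_eq0.
  have := hL v vp; rewrite hE.
  have [/hasP[i]|no] := boolP (has (fun i => t == alpha i) (iota 0 r.+1)).
    rewrite mem_iota ltnS /= => ir /eqP tE; rewrite tE in vt vq.
    rewrite (lies_over_at vp ir vt) leNgt.
    rewrite (floor_value_lt (L := k%:Z * lm i) m0 vt (ram_at vp ir vt)) //.
    rewrite (place_mono_at _ vp q0 ir vt) -/(nf k i).
    exact: value_lt_at.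
  have va' i : (i <= r)%N -> v (x - emb (alpha i)) = 0.
    move=> ir; have := place_pev_unit vp (p := 'X - (alpha i)%:P) vt1.
    rewrite pevXsubC hornerXsubC subr_eq0; case=> //.
    apply: contra no => ti; apply/hasP; exists i; rewrite ?mem_iota //.
  have nl : lies v = false.
    rewrite /lies_over; case: (leqP u r) => ur; first by rewrite va'.
    apply/negbTE; rewrite -leNgt -(vgeP v 0 x0).
    by apply: (vge_subC vp (c := t)); apply: vgeW vt1.
  rewrite nl (place_mono_unit _ vp q0 va') oppr0 => h1.
  have := le_trans h1 vq; rewrite oppr_ge0 => h2.
  by move: (lt_le_trans vt h2); rewrite ltxx.
have [d d0 bE] : exists2 d, d != 0 & b = d%:P by apply/size_poly1P.
exists (d^-1 *: a); split; last by rewrite hE bE pevC pevZ fmorphV [_ / _]mulrC.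
have [v [vp vx]] := place_infty_ex.
have na : d^-1 *: a != 0.
  rewrite scaler_eq0 negb_or invr_eq0 d0.
  by apply: contraNneq a0 => ->; rewrite rmorph0.
have sa : (0 < size (d^-1 *: a))%N by rewrite size_poly_gt0.
rewrite -(prednK sa) floor_dimP leNgt; apply/negP => lt.
have := hL v vp; rewrite lies_over_pole //.
have -> : h = mono_coef k * pev emb x (d^-1 *: a).
  by rewrite hE bE pevC pevZ fmorphV [_ / _]mulrC.
rewrite leNgt (floor_value_lt (L := k%:Z * lm r.+1) m0 _ (ram_pole vp vx)) ?oppr_gt0 //.
rewrite place_mono_pole // ler_pM2l ?oppr_gt0 // lerD2l lerN2 -/(nf k r.+1).
rewrite ler_pM2l ?ltz_nat // lerBrDr addrAC.
by rewrite [_ + \sum_(_ <= _ < _) _]addrC -floor_degS lezD1.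
Qed.

(** * Averaging over the Galois group *)

Lemma galois_sum (d : K) : d ^+ m = 1 -> exists sigma : F -> F,
  [/\ {morph sigma : a b / a + b}, {morph sigma : a b / a * b},
      forall h, ratfun emb x h -> sigma h = h
    & forall h : 'I_m -> F, (forall k, ratfun emb x (h k)) ->
        sigma (\sum_(k < m) h k * y ^+ k) = \sum_(k < m) h k * (emb d * y) ^+ k].
Proof.
move=> dm; have [s [sD sM sx sy]] :=
  kummer_galois mK f_neq0 tr (esym pev_f) notpow gen dm.
have s1 : s 1 = 1 by apply: sx; rewrite -(rmorph1 emb); apply: ratfun_emb.
have s0 : s 0 = 0 by apply: sx; rewrite -(rmorph0 emb); apply: ratfun_emb.
have sX a n : s (a ^+ n) = s a ^+ n.
  by elim: n => [|n IHn]; rewrite ?expr0 // !exprS sM IHn.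
exists s; split=> // h hx; rewrite (big_morph s sD s0).
by apply: eq_bigr => k _; rewrite sM sX sy sx.
Qed.

(** [sigma] fixes x, so [v \o s] is a place over the same point as [v]; the bound on z at [v \o s]
    is the bound on its image at [v]. *)
Lemma galois_inL (d : K) (h : 'I_m -> F) : d ^+ m = 1 ->
    (forall k, ratfun emb x (h k)) ->
  inL (\sum_(k < m) h k * y ^+ k) -> inL (\sum_(k < m) h k * (emb d * y) ^+ k).
Proof.
move=> dm hx /inLP hL; have [s [sD sM sx ssum]] := galois_sum dm.
rewrite -ssum //; set z := \sum_(k < m) _ in hL *.
have s1 : s 1 = 1 by apply: sx; rewrite -(rmorph1 emb); apply: ratfun_emb.
have s0 : s 0 = 0 by apply: sx; rewrite -(rmorph0 emb); apply: ratfun_emb.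
have snz a : a != 0 -> s a != 0.
  move=> a0; have : s a * s a^-1 != 0 by rewrite -sM mulfV // s1 oner_eq0.
  by rewrite mulf_eq0 negb_or => /andP[].
apply/inLP => v vp; have [vM vD vK [w [w0 vw]]] := vp.
have vsp : is_place emb (v \o s).
  split=> [a b a0 b0|a b a0 b0 ab0|a a0|] /=.
  - by rewrite sM vM ?snz.
  - by rewrite sD vD -?sD ?snz.
  - by rewrite sx ?vK //; apply: ratfun_emb.
  (* An element of value 1 for [v \o s] is a preimage of [w], obtained by dividing the k-th
     coordinate by d^k. *)
  have [g [gx wE]] := kummer_span w.
  have d0 : d != 0.
    apply/negP => /eqP d0; move: dm; rewrite d0 expr0n eqn0Ngt m0 => /esym/eqP.
    by rewrite oner_eq0.
  pose w' := \sum_(k < m) (g k / emb d ^+ k) * y ^+ k.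
  have sw : s w' = w.
    rewrite (ssum (fun k => g k / emb d ^+ k)); last first.
      move=> k; apply: ratfunM => //; apply: ratfunV; apply: ratfunX.
      exact: ratfun_emb.
    rewrite wE; apply: eq_bigr => k _; rewrite exprMn mulrA divfK //.
    by rewrite expf_neq0 // fmorph_eq0.
  exists w'; rewrite sw; split=> //; apply: contraNneq w0 => e0.
  by rewrite -sw e0 s0.
have sxE : s x = x by apply: sx; apply: ratfun_id.
have sxa : s (x - emb (alpha u)) = x - emb (alpha u).
  by apply: sx; rewrite -pevXsubC; apply: ratfun_pev.
have := hL _ vsp; rewrite /vge /lies_over /= sxE sxa.
by case/orP => [/eqP ->|->]; rewrite ?s0 ?eqxx ?orbT.
Qed.

(** Projection onto a character of the cyclic group: the sum over i of zeta^(-ik) sigma^i(z) is m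
    h_k y^k, and m is invertible in K. *)
Lemma inL_components (h : 'I_m -> F) : (forall k, ratfun emb x (h k)) ->
  inL (\sum_(k < m) h k * y ^+ k) -> forall k, inL (h k * y ^+ k).
Proof.
move=> hx hL k; have [z pz] := primitive_root_ex mK.
have z0 : z != 0.
  apply/negP => /eqP z0; have := prim_expr_order pz.
  by rewrite z0 expr0n eqn0Ngt m0 => /esym/eqP; rewrite oner_eq0.
have hLi i : inL (emb (z ^- k ^+ i) * \sum_(j < m) h j * (emb (z ^+ i) * y) ^+ j).
  apply: inLZ; apply: galois_inL => //.
  by rewrite -exprM mulnC exprM (prim_expr_order pz) expr1n.
have sumL : inL (\sum_(i < m)
    emb (z ^- k ^+ i) * \sum_(j < m) h j * (emb (z ^+ i) * y) ^+ j).
  by apply: (big_ind inL) => //; [exact: inL0|exact: inLD].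
have sumE : \sum_(i < m)
    emb (z ^- k ^+ i) * (\sum_(j < m) h j * (emb (z ^+ i) * y) ^+ j) =
    emb m%:R * (h k * y ^+ k).
  under eq_bigr => i _ do rewrite mulr_sumr.
  rewrite exchange_big (bigD1 k) //= [X in _ + X]big1 ?addr0.
    rewrite -[m in m%:R]card_ord -sumr_const rmorph_sum mulr_suml /=.
    apply: eq_bigr => i _; rewrite exprMn -rmorphXn mulrCA !mulrA -[_ * h k]mulrC.
    rewrite -!mulrA; congr (_ * _); rewrite mulrA -rmorphM rmorph1 /=.
    rewrite exprVn -exprM mulnC exprM mulVf ?rmorph1 ?mul1r //.
    by rewrite !expf_neq0.
  move=> j jk; have wE i : emb (z ^- k ^+ i) * (h j * (emb (z ^+ i) * y) ^+ j) =
      h j * y ^+ j * emb ((z ^- k * z ^+ j) ^+ i).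
    have -> : (emb (z ^+ i) * y) ^+ j = emb (z ^+ j ^+ i) * y ^+ j.
      by rewrite exprMn -rmorphXn -!exprM mulnC.
    rewrite exprMn rmorphM /=.
    set a := emb _; set b := emb _; set e := y ^+ _; ring.
  under eq_bigr => i _ do rewrite wE.
  rewrite -mulr_sumr -rmorph_sum /=; set w := z ^- k * z ^+ j.
  have w1 : w - 1 != 0.
    rewrite subr_eq0; apply: contra jk => /eqP w1; apply/eqP/val_inj => /=.
    have : z ^+ j == z ^+ k.
      by rewrite -[z ^+ j](mulVKf (expf_neq0 k z0)) -/w w1 mulr1.
    by rewrite (eq_prim_root_expr pz) !modn_small // => /eqP.
  (* For j != k the geometric sum vanishes, [w] being an m-th root of unity other than 1. *)
  have : (w - 1) * \sum_(i < m) w ^+ i = 0.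
    rewrite -subrX1 exprMn exprVn -!exprM ![(_ * m)%N]mulnC !exprM.
    by rewrite (prim_expr_order pz) !expr1n invr1 mulr1 subrr.
  by move/eqP; rewrite mulf_eq0 (negPf w1) => /eqP ->; rewrite rmorph0 mulr0.
rewrite sumE in sumL; have := inLZ m%:R^-1 sumL.
by rewrite fmorphV mulKf // fmorph_eq0.
Qed.

Lemma ell_is_finType (T : finType) (B : T -> F) :
    (forall i, inL (B i)) ->
    (forall cf : T -> K, \sum_i emb (cf i) * B i = 0 -> forall i, cf i = 0) ->
    (forall z, inL z -> exists cf : T -> K, z = \sum_i emb (cf i) * B i) ->
  ell_is emb x r alpha u c #|T|.
Proof.
move=> BL Bfree Bspan; exists (fun i => B (enum_val i)); split=> // [cf|z /Bspan].
  move=> h i; rewrite -[i]enum_valK; apply: (Bfree (cf \o enum_rank)).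
  rewrite -[RHS]h (reindex (fun i : 'I_#|T| => enum_val i)) /=; last first.
    exact: onW_bij (@enum_val_bij T).
  by apply: eq_bigr => j _; rewrite enum_valK.
move=> [cf ->]; exists (cf \o enum_val).
rewrite (reindex (fun i : 'I_#|T| => enum_val i)) //.
exact: onW_bij (@enum_val_bij T).
Qed.

(** The basis consists of [mono_coef k * x ^+ j * y ^+ k] with j < fdim k, indexed by dependent
    pairs. It is free because the y^k are independent over K(x) and x is transcendental; it spans
    because L(c D_u) contains the components of its elements. *)
Theorem ell_floor_dim :
  ell_is emb x r alpha u c (\sum_(k < m) fdim k)%N.
Proof.
pose T := {k : 'I_m & 'I_(fdim k)}.
have -> : (\sum_(k < m) fdim k = #|{: T}|)%N.
  rewrite card_tagged sumnE big_map big_enum /=.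
  by apply: eq_bigr => k _; rewrite card_ord.
pose B (p : T) : F := mono_coef (tag p) * x ^+ tagged p * y ^+ tag p.
have sumB (cf : forall k : 'I_m, 'I_(fdim k) -> K) :
    \sum_(p : T) emb (cf (tag p) (tagged p)) * B p = \sum_(k < m)
      (mono_coef k * pev emb x (\sum_(j < fdim k) cf k j *: 'X^j)) * y ^+ k.
  rewrite -(@sig_big_dep _ _ _ _ (fun k : 'I_m => 'I_(fdim k))
    xpredT (fun=> xpredT) (fun k j => emb (cf k j) * (mono_coef k * x ^+ j * y ^+ k))) /=.
  apply: eq_bigr => k _; rewrite rmorph_sum mulr_sumr mulr_suml.
  apply: eq_bigr => j _; rewrite /= pevZ rmorphXn /= pevX !mulrA.
  by rewrite [mono_coef k * _]mulrC.
apply: (@ell_is_finType T B) => [[k j]|cf h0 [k j]|z zL].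
- rewrite /B /= -(pevX emb x) -rmorphXn /= pevX; apply: mono_inL.
  by rewrite size_polyXn.
- have cfE : cf =1 fun p => cf (Tagged _ (tagged p)) by case.
  have {}h0 : \sum_(k < m) (mono_coef k *
      pev emb x (\sum_(j < fdim k) cf (Tagged _ j) *: 'X^j)) * y ^+ k = 0.
    rewrite -(sumB (fun k j => cf (Tagged _ j))) -[RHS]h0.
    by apply: eq_bigr => p _; rewrite -cfE.
  have := kummer_indep _ h0 k.
  move=> /(_ (fun k => ratfunM (ratfun_mono_coef k) (ratfun_pev _ _ _))).
  move/eqP; rewrite mulf_eq0 (negPf (mono_coef_neq0 k)) pev_eq0 //= => /eqP.
  move/(congr1 (fun p : {poly K} => p`_j)); rewrite coef0 coef_sum.
  rewrite (bigD1 j) //= coefZ coefXn eqxx mulr1 big1 ?addr0 // => i ij.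
  have /negPf ji : (j : nat) != i by rewrite eq_sym.
  by rewrite coefZ coefXn ji mulr0.
have [h [hx zE]] := kummer_span z.
have hL := inL_components hx; rewrite -zE in hL.
have [p hp] := fin_all_exists (fun k => inL_mono (hx k) (hL zL k)).
exists (fun q : T => (p (tag q))`_(nat_of_ord (tagged q))).
rewrite (sumB (fun k j => (p k)`_j)) zE; apply: eq_bigr => k _.
have [sp ->] := hp k; congr (_ * pev _ _ _ * _).
apply/polyP => j; rewrite coef_sum.
have [jp|pj] := ltnP j (size (p k)).
  have jd := leq_trans jp sp; rewrite (bigD1 (Ordinal jd)) //= coefZ coefXn eqxx.
  rewrite mulr1 big1 ?addr0 // => i ij.
  have /negPf ji : j != i by rewrite eq_sym.
  by rewrite coefZ coefXn ji mulr0.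
rewrite nth_default // big1 // => i _; rewrite coefZ coefXn.
by case: eqP => [<-|_]; rewrite ?mulr0 // nth_default ?mul0r.
Qed.

End KummerPlaces.

(** * Counting *)

(** The exponents of residue t among g full periods are t + j mu with j < g, the parametrization
    used in the count. *)
Lemma count_residue (mu t g : nat) (P : pred nat) : (t < mu)%N ->
  (\sum_(0 <= k < g * mu) ((k %% mu == t) && P k) =
   count (fun j => P (t + j * mu)) (iota 0 g))%N.
Proof.
move=> tmu; elim: g => [|g IHg]; first by rewrite mul0n big_geq.
rewrite (@big_cat_nat _ _ _ (g * mu)) ?leq_mul //.
rewrite IHg -[g.+1]addn1 iotaD count_cat /= addn0 add0n; congr (_ + _)%N.
rewrite -{1}[(g * mu)%N]add0n big_addn mulnDl mul1n addnC addnK.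
rewrite (bigD1_seq t) ?iota_uniq ?mem_index_iota //=.
rewrite (addnC t) modnMDl modn_small // eqxx big_nat_cond big1 => [|k].
  by rewrite addn0.
move=> /andP[/andP[_ kmu] kt].
by rewrite (addnC k) modnMDl modn_small // (negPf kt).
Qed.

Lemma divz_pred_step (mu a : int) : 0 < mu ->
  (a %/ mu)%Z = ((a - 1) %/ mu)%Z + (nat_of_bool (mu %| a)%Z)%:Z.
Proof.
move=> mu0; have mu1 : mu != 0 by lia.
have h1 := divz_eq a mu; have h2 := modz_ge0 a mu1.
have h3 := ltz_pmod a mu0; have h4 := divz_eq (a - 1) mu.
have h5 := modz_ge0 (a - 1) mu1; have h6 := ltz_pmod (a - 1) mu0.
case: (dvdz_mod0P (d := mu) (m := a)) => h /=; move: h h1 h2 h3 h4 h5 h6;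
  move: (a %% mu)%Z (a %/ mu)%Z ((a - 1) %% mu)%Z ((a - 1) %/ mu)%Z;
  clear - mu0; nia.
Qed.

Lemma floor_divz (a : int) (m : nat) : (0 < m)%N ->
  Num.floor (a%:~R / m%:R : rat) = (a %/ m%:Z)%Z.
Proof.
move=> m0; have m0R : 0 < m%:R :> rat by rewrite ltr0n.
apply: floor_def; rewrite ler_pdivlMr // ltr_pdivrMr //.
rewrite -[m%:R]/(m%:Z%:~R) -!intrM ler_int ltr_int.
by rewrite lez_floor ?ltz_ceil ?eqz_nat -?lt0n.
Qed.

(** The quotient of s - 1, rather than of s, is what puts the upper end s = mu (N + 1) inside the
    window. *)
Lemma floor_window (mu s : nat) : (0 < mu)%N -> (0 < s)%N ->
  (mu * (s.-1 %/ mu) < s <= mu * (s.-1 %/ mu).+1)%N.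
Proof.
move=> mu0 s0; apply/andP; split.
  by rewrite mulnC -[X in (_ < X)%N](prednK s0) ltnS leq_trunc_div.
by rewrite -[X in (X <= _)%N](prednK s0) mulnC ltn_ceil.
Qed.

(** * From the sign of the degree to the fractional parts *)

Section Criterion.
Variables (mu g s k N : nat) (m Lam Q d : int).
Hypotheses (mu0 : (0 < mu)%N) (g0 : (0 < g)%N) (mE : m = mu%:Z * g%:Z).
Hypothesis window : (mu * N < s <= mu * N.+1)%N.

Let w1 : m * N%:Z < s%:Z * g%:Z. Proof. by rewrite mE; nia. Qed.
Let w2 : s%:Z * g%:Z <= m * (1 + N%:Z). Proof. by rewrite mE; nia. Qed.
Let m0 : 0 < m. Proof. by rewrite mE; nia. Qed.

(** [Q] is the sum of the floors at the finite points, [Lam] the sum of the lambda_i, [d] the exact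
    quotient at [u]. Then k Lam - m Q = s g - m (Q + d), and m N < s g <= m (N + 1), so the bound
    fails exactly when Q + d is negative. *)
Lemma criterion_infty (l : int) : l * g%:Z = - Lam -> d * mu%:Z = s%:Z + k%:Z * l ->
  (0 <= Q + d) = (k%:Z * Lam - m * Q <= m * (1 + N%:Z)).
Proof.
move=> lE dE; have md : m * d = s%:Z * g%:Z - k%:Z * Lam.
  have -> : m * d = (d * mu%:Z) * g%:Z by rewrite mE; ring.
  rewrite dE mulrDl -mulrA lE; ring.
have -> : k%:Z * Lam - m * Q = s%:Z * g%:Z - m * (Q + d) by rewrite mulrDr md; ring.
move: w1 w2 m0; move: (s%:Z * g%:Z) (Q + d) N%:Z => S D M; clear => h1 h2 h3.
by apply/idP/idP => h; nia.
Qed.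

(** At a finite [u] the floor of k lambda_u / m gives way to [d]. The window forces their difference
    to be 1 + N, and the floor at infinity then unfolds to the stated inequality. *)
Lemma criterion_finite (l lu : int) : l * g%:Z = lu -> d * mu%:Z = s%:Z + k%:Z * l ->
  (0 <= Q - (k%:Z * lu %/ m)%Z + d + (k%:Z * - Lam %/ m)%Z) =
  (k%:Z * Lam - m * Q <= m * (1 + N%:Z)).
Proof.
move=> lE dE; have md : m * d = s%:Z * g%:Z + k%:Z * lu.
  have -> : m * d = (d * mu%:Z) * g%:Z by rewrite mE; ring.
  by rewrite dE mulrDl -mulrA lE.
have f1 : (k%:Z * lu %/ m)%Z * m <= k%:Z * lu by apply: lez_floor; rewrite gt_eqF.
have f2 : k%:Z * lu < ((k%:Z * lu %/ m)%Z + 1) * m by apply: ltz_ceil.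
have dq : d - (k%:Z * lu %/ m)%Z = 1 + N%:Z.
  move: w1 w2 m0 md f1 f2; move: (s%:Z * g%:Z) (k%:Z * lu) (_ %/ _)%Z N%:Z.
  by move=> S L q M; clear; nia.
have -> : Q - (k%:Z * lu %/ m)%Z + d = Q + (1 + N%:Z) by rewrite -dq; ring.
rewrite -lerBlDl sub0r lez_divRL //; move: (Q) (Lam) N%:Z; clear => Q' L M.
by apply/idP/idP; nia.
Qed.

End Criterion.

Section Counting.
Variables (m r : nat) (lam : nat -> nat) (u s t : nat).
Hypotheses (m0 : (0 < m)%N) (hu : (u <= r.+1)%N) (s0 : (0 < s)%N).

Local Notation lm := (lamE r lam).
Let lu := lm u.
Let gu := gcdn m `|lu|%N.
Let mu := (m %/ gu)%N.
Let l := (lu %/ gu%:Z)%Z.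

Hypothesis tmu : (t < mu)%N.
Hypothesis ht : (mu%:Z %| s%:Z + l * t%:Z)%Z.

Let g0 : (0 < gu)%N. Proof. by rewrite gcdn_gt0 m0. Qed.
Let mE : m = (mu * gu)%N. Proof. by rewrite divnK // dvdn_gcdl. Qed.
Let mu0 : (0 < mu)%N. Proof. exact: leq_ltn_trans tmu. Qed.
Let luE : lu = l * gu%:Z.
Proof. by rewrite divzK // dvdzE absz_nat dvdn_gcdr. Qed.

Let cop : coprimez mu%:Z l.
Proof.
rewrite /coprimez /gcdz /= eqz_nat -(eqn_pmul2r g0) mul1n muln_gcdl -mE.
by rewrite -[X in gcdn _ (_ * X)]absz_nat -abszM -luE.
Qed.

(** [l] is prime to [mu] and [t] is one solution, so the solutions form the class of [t]. *)
Lemma residue_dvd (k : nat) :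
  (mu%:Z %| s%:Z + k%:Z * l)%Z = ((k %% mu)%N == t).
Proof.
have -> : s%:Z + k%:Z * l = (s%:Z + l * t%:Z) + (k%:Z - t%:Z) * l by ring.
rewrite rpredDl // Gauss_dvdzl // -eqz_mod_dvd !modz_nat eqz_nat.
by rewrite [(t %% mu)%N]modn_small.
Qed.

Lemma nfloor_u c k : nfloor m r lam u c k u = ((c%:Z + k%:Z * l) %/ mu%:Z)%Z.
Proof.
rewrite /nfloor eqxx -/lu -/gu.
have -> : m%:Z = mu%:Z * gu%:Z by rewrite -PoszM -mE.
by rewrite luE PoszM mulrA -mulrDl divzMpr.
Qed.

Lemma nfloor_other c k i : i != u ->
  nfloor m r lam u c k i = (k%:Z * lm i %/ m%:Z)%Z.
Proof. by rewrite /nfloor => /negPf ->; rewrite add0r. Qed.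

Lemma floor_degE c k : floor_deg m r lam u c k =
  \sum_(0 <= i < r.+2 | i != u) (k%:Z * lm i %/ m%:Z)%Z
  + ((c%:Z + k%:Z * l) %/ mu%:Z)%Z.
Proof.
rewrite /floor_deg (bigD1_seq u) ?iota_uniq ?mem_index_iota //= nfloor_u addrC.
by congr (_ + _); apply: eq_bigr => i iu; rewrite nfloor_other.
Qed.

(** The floor at [u] rises, by one, only if mu divides s + k l. The dimension follows only if the
    new degree is nonnegative, which is why the degree is tested at s and not at s - 1. *)
Lemma floor_dim_step k : floor_dim m r lam u s k =
  (floor_dim m r lam u s.-1 k
   + (((k %% mu)%N == t) && (0 <= floor_deg m r lam u s k)%R))%N.
Proof.
have : floor_deg m r lam u s k =
    floor_deg m r lam u s.-1 k + (nat_of_bool ((k %% mu)%N == t))%:Z.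
  rewrite !floor_degE -residue_dvd -addrA divz_pred_step ?ltz_nat //.
  congr (_ + (_ + _)); congr divz; rewrite -[s in LHS](prednK s0) -addn1 PoszD.
  by ring.
rewrite /floor_dim => ->; move: (floor_deg _ _ _ _ _ _) => d; clear.
by case: (_ == t) => /=; rewrite ?andbF; do 2!case: ifP; lia.
Qed.

(** m times a fractional part is the remainder k lambda_i - m floor(k lambda_i / m); clearing m
    makes the rational inequality an integral one. *)
Lemma sum_fracp k :
  \sum_(0 <= i < r.+1) fracp ((k%:Z * lm i)%:~R / m%:R) =
  (k%:Z * - lm r.+1 - m%:Z * \sum_(0 <= i < r.+1) (k%:Z * lm i %/ m%:Z)%Z)%:~R
    / m%:R :> rat.
Proof.
have mR : m%:R != 0 :> rat by rewrite pnatr_eq0 -lt0n.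
set Q := \sum_(0 <= i < r.+1) (_ %/ _)%Z; rewrite -(sum_lamE r lam) mulr_sumr intrB.
have -> : (m%:Z * Q)%:~R = m%:R * Q%:~R :> rat by rewrite intrM.
rewrite mulrBl [m%:R * _ / _]mulrAC mulfV // mul1r /Q.
rewrite !rmorph_sum /=.
rewrite mulr_suml -sumrB; apply: eq_bigr => i _.
by rewrite /fracp floor_divz.
Qed.

Lemma sum_fracp_criterion k : (k %% mu)%N = t ->
  (\sum_(0 <= i < r.+1) fracp ((k%:Z * lm i)%:~R / m%:R)
     <= 1 + (s.-1 %/ mu)%:R :> rat) = (0 <= floor_deg m r lam u s k).
Proof.
move=> kt; have m0R : 0 < m%:R :> rat by rewrite ltr0n.
set N := (s.-1 %/ mu)%N.
have /dvdzP[d dE] : (mu%:Z %| s%:Z + k%:Z * l)%Z by rewrite residue_dvd kt.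
have mZ : m%:Z = mu%:Z * gu%:Z by rewrite -PoszM -mE.
have win := floor_window mu0 s0; rewrite -/N in win.
have lE : l * gu%:Z = lm u by rewrite -luE.
rewrite floor_degE dE mulzK; last by rewrite eqz_nat -lt0n.
rewrite sum_fracp ler_pdivrMr //.
have -> : (1 + N%:R) * m%:R = (m%:Z * (1 + N%:Z))%:~R :> rat.
  by rewrite intrM intrD mulrC.
rewrite ler_int; set Q := \sum_(0 <= i < r.+1) (_ %/ _)%Z.
have [ur|ur] := leqP u r; last first.
  have uE : u = r.+1 by apply/eqP; rewrite eqn_leq hu.
  have -> : \sum_(0 <= i < r.+2 | i != u) (k%:Z * lm i %/ m%:Z)%Z = Q.
    rewrite big_mkcond big_nat_recr //= uE eqxx addr0; apply: eq_big_nat => i.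
    by rewrite ltnS => /andP[_ ir]; rewrite ltn_eqF.
  apply/esym; apply: (criterion_infty _ mu0 g0 mZ win _ (esym dE)).
  by rewrite lE uE opprK.
have -> : \sum_(0 <= i < r.+2 | i != u) (k%:Z * lm i %/ m%:Z)%Z =
    Q - (k%:Z * lm u %/ m%:Z)%Z + (k%:Z * lm r.+1 %/ m%:Z)%Z.
  rewrite big_mkcond big_nat_recr //= gtn_eqF //=; congr (_ + _).
  rewrite -big_mkcond /Q [in RHS](bigD1_seq u) ?iota_uniq ?mem_index_iota //=.
  by rewrite addrAC subrr add0r.
rewrite -[lm r.+1 in RHS]opprK addrAC; apply/esym.
exact: (criterion_finite _ _ mu0 g0 mZ win lE (esym dE)).
Qed.

Theorem sum_floor_dim :
  (\sum_(k < m) floor_dim m r lam u s k =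
   \sum_(k < m) floor_dim m r lam u s.-1 k
   + count (fun j : nat => (\sum_(0 <= i < r.+1)
       fracp (((t + j * mu)%:Z * lm i)%:~R / m%:R)
       <= 1 + (s.-1 %/ mu)%:R :> rat)%R) (iota 0 gu))%N.
Proof.
rewrite -(count_residue _ (fun k => \sum_(0 <= i < r.+1)
  fracp ((k%:Z * lm i)%:~R / m%:R) <= 1 + (s.-1 %/ mu)%:R)) //.
rewrite mulnC -mE big_mkord -big_split /=; apply: eq_bigr => k _.
rewrite floor_dim_step; congr (_ + _)%N.
by case: eqP => //= kt; rewrite sum_fracp_criterion.
Qed.

End Counting.

Theorem mainTheorem4
  (K : closedFieldType) (F : fieldType) (emb : {rmorphism K -> F})
  (m r : nat) (alpha : nat -> K) (lam : nat -> nat) (x y : F)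
  (* Kummer extension F = K(x,y), y^m = f(x) *)
  (hm : (2 <= m)%N)
  (hchar : (m%:R : K) != 0)
  (hlam : forall i, (1 <= i <= r)%N -> (0 < lam i < m)%N)
  (* alpha_1..alpha_r pairwise distinct, alpha_0 := alpha 0 not among them *)
  (halpha : forall a b, (a <= r)%N -> (b <= r)%N -> a <> b -> alpha a <> alpha b)
  (hnotpow : forall d, (1 < d)%N -> (d %| m)%N ->
     ~ exists g : {fraction {poly K}},
         g ^+ d = FracField.tofrac (kummer_poly r alpha lam))
  (hxtr : forall p : {poly K}, (map_poly emb p).[x] = 0 -> p = 0)
  (hy : y ^+ m = \prod_(1 <= i < r.+1) (x - emb (alpha i)) ^+ lam i)
  (hgen : forall z : F, exists p q : {poly {poly K}},
     evalxy emb x y q != 0 /\ z = evalxy emb x y p / evalxy emb x y q)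
  (u : nat) (hu : (u <= r.+1)%N)
  (s : nat) (hs : (1 <= s)%N)
  (t : nat) :
  let lu := lamE r lam u in
  let gu := gcdn m `|lu|%N in
  let mu := (m %/ gu)%N in
  (t < mu)%N ->
  (mu%:Z %| s%:Z + (lu %/ gu%:Z)%Z * t%:Z)%Z ->
  exists n1 n2 : nat,
    [/\ ell_is emb x r alpha u s n1,
        ell_is emb x r alpha u s.-1 n2
      & n1 = (n2 + count (fun j : nat =>
               (\sum_(0 <= i < r.+1)
                  fracp (((t + j * mu)%:Z * lamE r lam i)%:~R / m%:R)
               <= 1 + ((s.-1) %/ mu)%:R :> rat)%R)
             (iota 0 gu))%N].
Proof.
move=> lu gu mu tmu ht; have m0 : (0 < m)%N by apply: leq_trans hm.
exists (\sum_(k < m) floor_dim m r lam u s k)%N.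
exists (\sum_(k < m) floor_dim m r lam u s.-1 k)%N; split.
- exact: (ell_floor_dim hchar halpha hnotpow hxtr hy hgen s hu).
- exact: (ell_floor_dim hchar halpha hnotpow hxtr hy hgen s.-1 hu).
- exact: sum_floor_dim.
Qed.
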